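(* Let $h\ge 0$ be an integer, let $\pi$ be an $h$-homogeneous Poisson structure on $\mathbb{R}^n$, and let $\overline{\chi}^{h}_{w}$ denote the Euler characteristic of the weight-$w$ cohomology groups $\overline{H}^{\bullet}_{w}$ of the Lie algebra $\overline{\mathfrak g}=\mathbb{R}[x_1,\dots,x_n]/\mathbb{R}$. Then for every integer weight $w$ $$\overline{\chi}^{h}_{w}=\overline{\chi}^{h}_{w+1-h}+\sum_{m}(-1)^m\sum_{\lambda=[k_1,k_2,\dots]\in \overline{C}^{\,m-1}_{w+1-h}}\frac{1+n}{1+k_1}\,\dim\lambda\;+\;\sum_{m}(-1)^m\sum_{\lambda=[k_1,k_2,\dots]\in\nabla^{w+(1-h)m}_{m}}\ \prod_{i\ge 1}\binom{d_{i+1}}{k_i},$$ where $d_j=\binom{n-1+j}{j}$, the notation $\lambda\in\overline{C}^{\,m-1}_{w+1-h}$ means that $\lambda$ runs over the set of Young diagrams $\nabla^{\,w+1-h+(2-h)(m-1)}_{m-1}$ indexing the direct summands of $\overline{C}^{\,m-1}_{w+1-h}$, and $\dim\lambda=\prod_{j\ge 1}\binom{d_j}{k_j}$.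
   Context: A Poisson structure $\pi=\frac12\sum_{i,j}p_{ij}\,\partial_i\wedge\partial_j$ ($p_{ij}=-p_{ji}$) on $\mathbb{R}^n$ is $h$-homogeneous if every $p_{ij}=\{x_i,x_j\}$ is a homogeneous polynomial of degree $h$. Then $\mathbb{R}[x_1,\dots,x_n]$ is a Lie algebra under the Poisson bracket, and $\overline{\mathfrak g}=\mathbb{R}[x_1,\dots,x_n]/\mathbb{R}$ is its quotient by the constants. Let $\overline{S}_j$ be the space of homogeneous polynomials of degree $j$ and $\overline{\mathfrak S}_j$ its dual, $d_j=\dim\overline{\mathfrak S}_j=\binom{n-1+j}{j}$. The $m$-th cochain space of $\overline{\mathfrak g}$ of weight $w$ is $$\overline{C}^{\,m}_{w}=\bigoplus \Lambda^{k_1}\overline{\mathfrak S}_1\otimes\Lambda^{k_2}\overline{\mathfrak S}_2\otimes\cdots\otimes\Lambda^{k_\ell}\overline{\mathfrak S}_\ell,$$ the sum being over sequences of non-negative integers $(k_1,k_2,\dots)$ (finitely many non-zero) with $\sum_{j\ge1}k_j=m$ and $\sum_{j\ge 1}(j-2+h)k_j=w$ (summands with some $k_j>d_j$ vanish). The Lie algebra coboundary operator $(d\sigma)(f_0,\dots,f_m)=\sum_{i<j}(-1)^{i+j}\sigma(\{f_i,f_j\},\dots,\widehat{f_i},\dots,\widehat{f_j},\dots)$ maps $\overline{C}^{\,m}_w$ to $\overline{C}^{\,m+1}_w$; $\overline{H}^{m}_{w}$ denotes the resulting cohomology and $\overline{\chi}^{h}_{w}=\sum_m(-1)^m\dim\overline{H}^m_w=\sum_{m}(-1)^m\dim\overline{C}^{\,m}_w$.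 Young diagram notation: $\lambda=[k_1,k_2,\dots]$ denotes the Young diagram having exactly $k_i$ rows of length $i$; its height (number of rows) is $\sum k_i$ and its area (number of cells) is $\sum i k_i$. $\nabla^{A}_{m}$ is the set of Young diagrams with area $A$ and height $m$; $\nabla^0_0$ consists of the empty diagram only, and $\nabla^A_m=\emptyset$ if $m<0$, if $A<m$, or if $m=0$ and $A>0$. The summands of $\overline{C}^{\,m}_w$ correspond to the elements of $\nabla^{w+(2-h)m}_m$, and $\dim\lambda=\prod_j\binom{d_j}{k_j}$ is the dimension of the summand corresponding to $\lambda$. All sums over $m$ run over $m\ge 0$ and have only finitely many non-zero terms. *)

(* Defs.v *)
From mathcomp Require Export all_boot all_order all_algebra.
From mathcomp Require Export boolp classical_sets functions fsbigop reals.
From mathcomp Require Export mpoly.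

Set Implicit Arguments.
Unset Strict Implicit.
Unset Printing Implicit Defensive.

Import Order.TTheory GRing.Theory Num.Theory.

Local Open Scope classical_set_scope.
Local Open Scope ring_scope.

(** Poisson structures *)

Section Poisson.
Variables (R : realType) (n : nat).
Implicit Types (p : 'M[{mpoly R[n]}]_n) (f g : {mpoly R[n]}).

(* pi = 1/2 sum_(i,j) p_ij d_i /\ d_j, normalised so that {x_i, x_j} = p_ij *)
Definition pbracket p f g : {mpoly R[n]} :=
  \sum_i \sum_j p i j * mderiv i f * mderiv j g.

Definition homogeneous_poisson (h : nat) p : Prop :=
  [/\ forall i j, p i j = - p j i,
      forall i j, p i j \is h.-homog
    & forall f g k, pbracket p f (pbracket p g k)
        + pbracket p g (pbracket p k f) + pbracket p k (pbracket p f g) = 0].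

End Poisson.

(** Linear spans, and dimensions of quotients of possibly infinite-dimensional
    vector spaces *)

Section Dimension.
Variables (R : realType) (V : lmodType R).

Definition lspan (G : set V) : set V :=
  [set v | exists k (c : 'I_k -> R) (e : 'I_k -> V),
     (forall i, G (e i)) /\ v = \sum_i c i *: e i].

(* the classes of e_0, ..., e_(k-1) form a basis of Z / B *)
Definition quotient_basis (Z B : set V) (k : nat) (e : 'I_k -> V) : Prop :=
  (forall i, Z (e i)) /\
  (forall z, Z z -> exists! c : 'rV[R]_k, B (z - \sum_i c 0 i *: e i)).

(* dim (Z / B), for linear subspaces B of Z; it is 0 by convention if the
   quotient is infinite-dimensional *)
Definition quotient_dim (Z B : set V) : nat :=
  xget 0%N [set k | exists e : 'I_k -> V, quotient_basis Z B e].

End Dimension.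

(** Young diagrams *)

(* A Young diagram is the non-increasing sequence of the lengths of its rows;
   in the notation [k_1, k_2, ...], k_i is the number of rows of length i *)
Definition young (l : seq nat) : bool := sorted geq l && (0%N \notin l).

Definition rows (l : seq nat) (i : nat) : nat := count_mem i l.

Definition nabla (A m : int) : set (seq nat) :=
  [set l | [/\ young l, (size l)%:Z = m & (sumn l)%:Z = A]].

(* the dimension of the space of homogeneous polynomials of degree j >= 1 in
   n variables *)
Definition dS (n j : nat) : nat := 'C(n + j - 1, j).

(* In the two products the omitted factors are 1, since no row is longer than
   the area sumn l *)
Definition dimY (n : nat) (l : seq nat) : nat :=
  (\prod_(1 <= j < (sumn l).+1) 'C(dS n j, rows l j))%N.

Definition dimY_shift (n : nat) (l : seq nat) : nat :=
  (\prod_(1 <= i < (sumn l).+1) 'C(dS n i.+1, rows l i))%N.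

(** The weighted cochain complex of R[x_1, ..., x_n] / R *)

Section Cohomology.
Variables (R : realType) (n : nat).
Variables (h : nat) (p : 'M[{mpoly R[n]}]_n).

Local Notation P := {mpoly R[n]}.

(* Functions of m polynomials. The cochains below are alternating multilinear
   and vanish as soon as an argument is constant, i.e. they are forms on the
   quotient R[x_1, ..., x_n] / R, written on representatives. *)
Local Notation form m := (('I_m -> P) -> R^o).

(* The dual of the space of homogeneous polynomials of degree j, extended by 0
   to the other degrees *)
Definition dualS (j : nat) (z : P -> R) : Prop :=
  scalar z /\ forall f, z (pihomog mdeg j f) = z f.

Definition wedge (m : nat) (z : 'I_m -> P -> R) : form m :=
  fun f => \det (\matrix_(a < m, b < m) z a (f b)).

(* The tensor product of the k_j-th exterior powers of the duals of the spaces
   of homogeneous polynomials of degree j, embedded in the m-forms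
   (m = k_1 + k_2 + ...), is spanned by the wedge products of m functionals of
   which k_j have degree j. Here l lists the degrees of the functionals, so
   k_j = rows l j, and the sum below is that of the (j - 2 + h) k_j. *)
Definition cochains (m : nat) (w : int) : set (form m) :=
  lspan [set s | exists (l : seq nat) (z : 'I_m -> P -> R),
    [/\ young l, size l = m, \sum_(j <- l) (j%:Z - 2 + h%:Z) = w,
        forall a : 'I_m, dualS (nth 0%N l a) (z a) & s = wedge z]].
Arguments cochains : clear implicits.

(* The arguments of s are {f_i, f_j} followed by the other f_k in order. *)
Definition coboundary (m : nat) (s : form m) : form m.+1 :=
  fun f => \sum_(i < m.+1) \sum_(j < m.+1 | (i < j)%N)
    (-1) ^+ (i + j)%N *
    s (fun k => nth 0 (pbracket p (f i) (f j) ::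
         [seq f a | a <- enum 'I_m.+1 & (a != i) && (a != j)]) k).

Definition cocycles (m : nat) (w : int) : set (form m) :=
  cochains m w `&` [set s | coboundary s = 0].
Arguments cocycles : clear implicits.

Definition coboundaries (m : nat) (w : int) : set (form m) :=
  match m with
  | 0%N => [set 0]
  | m'.+1 => @coboundary m' @` cochains m' w
  end.
Arguments coboundaries : clear implicits.

Definition dimH (m : nat) (w : int) : nat :=
  quotient_dim (cocycles m w) (coboundaries m w).

Definition euler_char (w : int) : int :=
  \sum_(m \in [set: nat]) (-1) ^+ m * (dimH m w)%:Z.

End Cohomology.

Arguments cochains {R n} h m w _.
Arguments cocycles {R n} h p m w _.
Arguments coboundaries {R n} h p m w _.

(* Main.v *)
From HB Require Import structures.
Require Import Defs.
From mathcomp Require Import fingroup perm cardinality finmap ring zify.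
Import Order.TTheory GRing.Theory Num.Theory.
Local Open Scope classical_set_scope.
Local Open Scope ring_scope.

(** The coboundary operator preserves the weight, so for each weight [w] it
    makes the cochains into a complex of finite-dimensional spaces, which vanish
    in large degrees. By rank-nullity (euler_poincare) the Euler characteristic
    of the cohomology is the alternating sum of the dimensions of the cochain
    spaces, and the recursion becomes an identity between numbers of cochains.

    That identity comes from splitting the Young diagrams according to whether
    they have a row of length 1 (nabla_split). Deleting one row of length 1
    lowers the number of rows by 1 and the weight by h - 1, so the diagrams
    having such a row correspond to the summands of degree m - 1 and weight
    w + 1 - h. In the dimension, putting the row back turns the factor 'C(n, k)
    of the rows of length 1 into
      'C(n, k + 1) = (1 + n) / (1 + k) * 'C(n, k) - 'C(n, k);
    the first term gives the second summand of the statement, and the second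
    term, because of the shift from m - 1 to m, gives the Euler characteristic of
    weight w + 1 - h with a positive sign. A diagram without rows of length 1 is
    obtained from an arbitrary one of the same height by adding a cell to each
    row, which turns d_i into d_(i + 1): this is the last summand
    (sum_nabla_recursion).

    Two facts about cochains have to be provided. Both rest on an intrinsic
    description (cochainsE): the cochains of weight [w] are the alternating
    multilinear forms that vanish on constants and, evaluated on homogeneous
    polynomials, vanish unless the weights of the arguments add up to [w].
    - The coboundary preserves these three properties and squares to zero. This
      is proved by induction on the number of arguments. With i_x the insertion
      of x as first argument and L_x the Lie derivative, Cartan's formulas
      i_x d = L_x - d i_x (contract_ce_diff) and i_y L_x = L_x i_y - i_[x, y]
      (contract_lie) express the first insertion into d s and L_x s by forms
      with fewer arguments.
    - The dimension is the sum of the dimensions of the Young diagrams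
      (dimC_nabla). A multilinear form is determined by its values on monomials,
      hence an alternating one by its values on sets of distinct monomials. The
      wedge products of the corresponding coefficient functionals form a basis
      (cochains_basis); sorting the m monomials by degree turns the index sets
      of this basis into the diagrams, and the sets with a given diagram are
      counted one degree at a time (card_sets_by_class). *)

Set Implicit Arguments.
Unset Strict Implicit.
Unset Printing Implicit Defensive.

(** * Alternating forms and the Chevalley-Eilenberg complex *)

Section Forms.
Variables (R : comNzRingType) (V : lmodType R).
Local Notation form m := (('I_m -> V) -> R^o).

(** Tuples of arguments are taken apart at the head, because all claims about the
    differential are proved by induction on the number of arguments. *)
Definition fcons m (x : V) (f : 'I_m -> V) : 'I_m.+1 -> V :=
  fun k => if unlift ord0 k is Some j then f j else x.

Definition fupd m (f : 'I_m -> V) (i : 'I_m) (x : V) : 'I_m -> V :=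
  fun k => if k == i then x else f k.

Definition fnth m (r : seq V) : 'I_m -> V := fun k => nth 0 r k.

Lemma fcons0 m x (f : 'I_m -> V) : fcons x f ord0 = x.
Proof. by rewrite /fcons unlift_none. Qed.

Lemma fconsS m x (f : 'I_m -> V) i : fcons x f (lift ord0 i) = f i.
Proof. by rewrite /fcons liftK. Qed.

Lemma fcons_eta m (f : 'I_m.+1 -> V) :
  fcons (f ord0) (fun j => f (lift ord0 j)) = f.
Proof. by apply/funext => k; rewrite /fcons; case: unliftP => [j|] ->. Qed.

Lemma fupd_same m (f : 'I_m -> V) i x : fupd f i x i = x.
Proof. by rewrite /fupd eqxx. Qed.

Lemma fupd_fcons0 m x y (f : 'I_m -> V) : fupd (fcons x f) ord0 y = fcons y f.
Proof.
by apply/funext => k; rewrite /fupd /fcons; case: unliftP => [j|] ->.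
Qed.

Lemma fupd_fconsS m x y (f : 'I_m -> V) i :
  fupd (fcons x f) (lift ord0 i) y = fcons x (fupd f i y).
Proof.
by apply/funext => k; rewrite /fupd /fcons; case: unliftP => [j|] ->.
Qed.

Lemma fnth_cons m x r : fnth (x :: r) = fcons x (fnth r) :> ('I_m.+1 -> V).
Proof. by apply/funext => k; rewrite /fnth /fcons; case: unliftP => [j|] ->. Qed.

Lemma fnth_enum m (f : 'I_m -> V) : fnth [seq f a | a <- enum 'I_m] = f.
Proof.
apply/funext => k; rewrite /fnth (nth_map k) ?size_enum_ord //.
by rewrite nth_ord_enum.
Qed.

(** How a list of selected arguments, as it occurs in the coboundary, splits off
    its head when the tuple of arguments has the shape [fcons x f]. *)
Lemma map_fcons m x (f : 'I_m -> V) (P : pred 'I_m.+1) :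
  [seq fcons x f a | a <- enum 'I_m.+1 & P a] =
  (if P ord0 then [:: x] else [::]) ++
  [seq f a | a <- enum 'I_m & P (lift ord0 a)].
Proof.
have fE : [seq fcons x f a | a <- [seq lift ord0 a | a <- enum 'I_m & P (lift ord0 a)]]
    = [seq f a | a <- enum 'I_m & P (lift ord0 a)].
  by rewrite -map_comp; apply: eq_map => a /=; rewrite fconsS.
by rewrite enum_ordSl /= filter_map; case: (P ord0); rewrite /= ?fcons0 fE.
Qed.

Definition multilinear m (s : form m) : Prop := forall i f c x y,
  s (fupd f i (c *: x + y)) = c * s (fupd f i x) + s (fupd f i y).

Definition alternating m (s : form m) : Prop := forall i j f,
  i != j -> f i = f j -> s f = 0.

Definition altform m (s : form m) : Prop := multilinear s /\ alternating s.

Definition contract m (x : V) (s : form m.+1) : form m := fun f => s (fcons x f).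

Lemma contract_linl m c x y (s : form m.+1) : multilinear s ->
  contract (c *: x + y) s = c *: contract x s + contract y s.
Proof.
move=> ls; apply/funext => f.
by have := ls ord0 (fcons 0 f) c x y; rewrite !fupd_fcons0.
Qed.

Lemma contract0 m (s : form m.+1) : multilinear s -> contract 0 s = 0.
Proof.
by move=> ls; have := contract_linl (-1) 0 0 ls; rewrite scaler0 addr0 scaleN1r addNr.
Qed.

Lemma contractB m x (s t : form m.+1) :
  contract x (s - t) = contract x s - contract x t.
Proof. by []. Qed.

Lemma alt_contract m x (s : form m.+1) : altform s -> altform (contract x s).
Proof.
move=> [ls as_]; split => [i f c y z|i j f ij fij].
  by rewrite /contract -!fupd_fconsS ls.
by apply: (as_ (lift ord0 i) (lift ord0 j)); rewrite ?(inj_eq lift_inj) ?fconsS.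
Qed.

Lemma alt_linear m c (s t : form m) : altform s -> altform t ->
  altform (c *: s + t).
Proof.
move=> [ls as_] [lt at_]; split => [i f b y z|i j f ij fij].
  by rewrite !fctE ls lt /GRing.scale /=; ring.
by rewrite !fctE (as_ i j) // (at_ i j) // scaler0 addr0.
Qed.

Lemma altB m (s t : form m) : altform s -> altform t -> altform (s - t).
Proof.
move=> hs ht; rewrite addrC -scaleN1r; exact: alt_linear.
Qed.

Lemma alt0 m : altform (0 : form m).
Proof. by split => [i f c x y|i j f _ _]; rewrite ?fctE //= mulr0 addr0. Qed.

Lemma contract2 m x (s : form m.+2) : altform s -> contract x (contract x s) = 0.
Proof.
move=> [_ as_]; apply/funext => f; apply: (as_ ord0 (lift ord0 ord0)) => //.
by rewrite fcons0 fconsS fcons0.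
Qed.

(** The hypotheses are those that are available while a form is being shown to
    be alternating, which is why they are about contractions only; the proof is
    polarisation. *)
Lemma contract_anti m x y (t : form m.+2) :
  (forall z c u v, contract z (contract (c *: u + v) t) =
     c *: contract z (contract u t) + contract z (contract v t)) ->
  (forall z c u v, contract (c *: u + v) (contract z t) =
     c *: contract u (contract z t) + contract v (contract z t)) ->
  (forall z, contract z (contract z t) = 0) ->
  contract y (contract x t) = - contract x (contract y t).
Proof.
move=> l1 l2 a; apply/eqP; rewrite -addr_eq0; apply/eqP.
have := a (x + y).
have -> : x + y = 1 *: x + y by rewrite scale1r.
by rewrite l1 !l2 !a !scale1r add0r addr0 addrC.
Qed.

Lemma contract_swap m x y (s : form m.+2) : altform s ->
  contract y (contract x s) = - contract x (contract y s).
Proof.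
move=> hs; apply: contract_anti => [z c u v|z c u v|z].
- by rewrite contract_linl //; case: hs.
- by rewrite contract_linl //; case: (alt_contract z hs).
- exact: contract2.
Qed.

(** The induction step in the proofs that Lie derivatives and differentials are
    alternating. The contractions do not see an equality between the first
    argument and one after the second; exchanging the first two arguments brings
    both arguments into a contraction. *)
Lemma alt_intro m (s : form m.+1) :
  (forall x, altform (contract x s)) ->
  (forall c x y, contract (c *: x + y) s = c *: contract x s + contract y s) ->
  (match m return form m.+1 -> Prop with
   | 0 => fun _ => True
   | m'.+1 => fun t => forall x, contract x (contract x t) = 0
   end s) ->
  altform s.
Proof.
move=> hc hl h2; split => [i f c x y|].
  rewrite -(fcons_eta f); case: (unliftP ord0 i) => [j|] ->.
    rewrite !fupd_fconsS.
    by have [lc _] := hc (f ord0); have := lc j (fun j => f (lift ord0 j)) c x y.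
  rewrite !fupd_fcons0.
  by have := congr1 (fun t => t (fun j => f (lift ord0 j))) (hl c x y).
have main x (g : 'I_m -> V) j : g j = x -> s (fcons x g) = 0.
  case: m s hc hl h2 g j => [|m] s hc hl h2 g j; first by case: j.
  rewrite -(fcons_eta g); move: (g ord0) (fun i => _) => y {}g.
  case: (unliftP ord0 j) => [k|] ->; rewrite ?fconsS ?fcons0; last first.
    by move=> ->; have := congr1 (fun t => t g) (h2 x).
  move=> gk; rewrite -[LHS]/(contract y (contract x s) g).
  rewrite contract_anti //; last first.
  - by move=> z c u v; rewrite contract_linl //; case: (hc z).
  - by move=> z c u v; rewrite hl.
  have [_ ac] := hc y.
  rewrite -[LHS]/(- contract y s (fcons x g)) (ac ord0 (lift ord0 k)) ?oppr0 //.
  by rewrite fcons0 fconsS.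
move=> i j f; rewrite -(fcons_eta f); move: (f ord0) (fun j => _) => x g.
case: (unliftP ord0 i) => [k|] ->; case: (unliftP ord0 j) => [l|] ->;
  rewrite ?fconsS ?fcons0 ?(inj_eq lift_inj) ?eqxx //.
- move=> kl gkl; have [_ ac] := hc x; exact: (ac k l).
- by move=> _ /main.
- by move=> _ /esym /main.
Qed.

End Forms.

Section ChevalleyEilenberg.
Variables (R : comNzRingType) (V : lmodType R) (br : V -> V -> V).
Local Notation form m := (('I_m -> V) -> R^o).

Hypothesis br_linr : forall c x y z, br x (c *: y + z) = c *: br x y + br x z.
Hypothesis br_linl : forall c x y z, br (c *: x + y) z = c *: br x z + br y z.
Hypothesis br_jacobi : forall x y z, br x (br y z) - br y (br x z) = br (br x y) z.
Hypothesis brxx : forall x, br x x = 0.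

(** The Lie derivative - sum_j s (f_0, ..., [x, f_j], ...), with each bracket
    moved to the front of the arguments as in the differential; the move
    contributes (-1)^j to the sign. *)
Definition lie m (x : V) (s : form m) : form m := fun f =>
  \sum_(j < m) (-1) ^+ j.+1 *
    s (fnth (br x (f j) :: [seq f a | a <- enum 'I_m & a != j])).

(** The Chevalley-Eilenberg differential with trivial coefficients. *)
Definition ce_diff m (s : form m) : form m.+1 := fun f =>
  \sum_(i < m.+1) \sum_(j < m.+1 | (i < j)%N) (-1) ^+ (i + j)%N *
    s (fnth (br (f i) (f j) ::
         [seq f a | a <- enum 'I_m.+1 & (a != i) && (a != j)])).

Lemma lie_lin m x c (s t : form m) : lie x (c *: s + t) = c *: lie x s + lie x t.
Proof.
apply/funext => f; rewrite !fctE /lie /GRing.scale /= mulr_sumr -big_split /=.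
by apply: eq_bigr => j _; rewrite ?fctE /GRing.scale /=; ring.
Qed.

Lemma lieB m x (s t : form m) : lie x (s - t) = lie x s - lie x t.
Proof. by rewrite addrC -scaleN1r lie_lin scaleN1r addrC. Qed.

Lemma lie0 m x : lie x (0 : form m) = 0.
Proof. by rewrite -[X in lie x X](subrr 0) lieB subrr. Qed.

Lemma lie_nil x (s : form 0) : lie x s = 0.
Proof. by apply/funext => f; rewrite /lie big_ord0. Qed.

Lemma ce_diff_lin m c (s t : form m) :
  ce_diff (c *: s + t) = c *: ce_diff s + ce_diff t.
Proof.
apply/funext => f; rewrite !fctE /ce_diff /GRing.scale /= mulr_sumr -big_split /=.
apply: eq_bigr => i _; rewrite mulr_sumr -big_split /=.
by apply: eq_bigr => j _; rewrite ?fctE /GRing.scale /=; ring.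
Qed.

Lemma ce_diffB m (s t : form m) : ce_diff (s - t) = ce_diff s - ce_diff t.
Proof. by rewrite addrC -scaleN1r ce_diff_lin scaleN1r addrC. Qed.

Lemma ce_diff0 m : ce_diff (0 : form m) = 0.
Proof. by rewrite -[X in ce_diff X](subrr 0) ce_diffB subrr. Qed.

Lemma ce_diff_nil (s : form 0) : ce_diff s = 0.
Proof.
apply/funext => f; rewrite /ce_diff big_ord_recl big_ord0 addr0.
by rewrite big_pred0 // => -[[]].
Qed.

(** i_y L_x = L_x i_y - i_[x, y]: in L_x s, the term with j = 0 is the bracket of
    x and y, and in the others y is the second argument and is exchanged with
    the first. *)
Lemma contract_lie m x y (s : form m.+1) : altform s ->
  contract y (lie x s) = lie x (contract y s) - contract (br x y) s.
Proof.
move=> hs; apply/funext => f.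
rewrite /contract {1}/lie big_ord_recl expr1 mulN1r addrC fctE; congr (_ + _).
  rewrite /lie; apply: eq_bigr => j _.
  rewrite map_fcons /= fconsS /bump /= add1n -cat1s.
  have -> : [seq f a | a <- enum 'I_m & lift ord0 a != lift ord0 j] =
            [seq f a | a <- enum 'I_m & a != j].
    by congr map; apply: eq_filter => a; rewrite (inj_eq lift_inj).
  case: m s hs f j => [|m] s hs f j; first by case: j.
  rewrite !cat1s !fnth_cons.
  have := congr1 (fun t => t (fnth [seq f a | a <- enum 'I_m.+1 & a != j]))
     (contract_swap y (br x (f j)) hs).
  rewrite /contract !fctE => ->.
  by rewrite exprS mulN1r mulrN mulNr.
rewrite fcons0 map_fcons eqxx /=; congr (- s _).
rewrite fnth_cons; congr fcons.
rewrite -[RHS]fnth_enum; congr (fnth (map _ _)).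
by apply/all_filterP/allP.
Qed.

(** Cartan's formula: in the coboundary, the terms with i = 0 form the Lie
    derivative, and the others are those of the coboundary of the contraction
    after exchanging the first two arguments. *)
Lemma contract_ce_diff m x (s : form m.+1) : altform s ->
  contract x (ce_diff s) = lie x s - ce_diff (contract x s).
Proof.
move=> hs; apply/funext => f.
rewrite /contract {1}/ce_diff big_ord_recl fctE; congr (_ + _).
  rewrite big_mkcond big_ord_recl /= add0r /lie.
  apply: eq_bigr => j _; rewrite /bump /= add1n add0n.
  rewrite map_fcons fcons0 fconsS /=.
  have -> // : [seq f a | a <- enum 'I_m.+1 & lift ord0 a != lift ord0 j] =
            [seq f a | a <- enum 'I_m.+1 & a != j].
  by congr map; apply: eq_filter => a; rewrite (inj_eq lift_inj).
rewrite /ce_diff fctE -sumrN; apply: eq_bigr => i _.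
rewrite big_mkcond big_ord_recl /= add0r -sumrN [RHS]big_mkcond /=.
apply: eq_bigr => j _; rewrite /bump /= !add1n ltnS; case: ifP => // ij.
rewrite map_fcons !fconsS /=.
have -> : [seq f a | a <- enum 'I_m.+1 &
              (lift ord0 a != lift ord0 i) && (lift ord0 a != lift ord0 j)] =
            [seq f a | a <- enum 'I_m.+1 & (a != i) && (a != j)].
    by congr map; apply: eq_filter => a; rewrite !(inj_eq lift_inj).
case: m s hs f i j ij => [|m] s hs f i j ij.
  by move: ij; rewrite (ord1 i) (ord1 j).
rewrite !fnth_cons.
have := congr1 (fun t => t (fnth [seq f a | a <- enum 'I_m.+2 & (a != i) && (a != j)]))
     (contract_swap x (br (f i) (f j)) hs).
rewrite /contract !fctE => ->.
by rewrite addSn addnS !exprS !mulN1r opprK mulrN opprK.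
Qed.

Lemma alt_lie m x (s : form m) : altform s -> altform (lie x s).
Proof.
elim: m s => [|m IH] s hs; first by rewrite lie_nil; exact: alt0.
have [ls _] := hs.
apply: alt_intro => [y|c y z|].
- rewrite contract_lie //; apply: altB; last exact: alt_contract.
  exact/IH/alt_contract.
- rewrite !contract_lie // br_linr !contract_linl // lie_lin.
  by apply/funext => f; rewrite !fctE /GRing.scale /=; ring.
- case: m IH s hs ls => [//|m] IH s hs ls y.
  rewrite contract_lie // contractB contract_lie; last exact: alt_contract.
  rewrite contract2 // lie0 sub0r (contract_swap (br x y)) // opprK.
  by rewrite addNr.
Qed.

Lemma alt_ce_diff m (s : form m) : altform s -> altform (ce_diff s).
Proof.
elim: m s => [|m IH] s hs; first by rewrite ce_diff_nil; exact: alt0.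
have [ls _] := hs.
have lie_linl c x y : lie (c *: x + y) s = c *: lie x s + lie y s.
  apply/funext => f; rewrite !fctE /lie /GRing.scale /= mulr_sumr -big_split /=.
  apply: eq_bigr => j _; rewrite br_linl !fnth_cons.
  have := congr1 (fun t => t (fnth [seq f a | a <- enum 'I_m.+1 & a != j]))
     (contract_linl c (br x (f j)) (br y (f j)) ls).
  by rewrite /contract !fctE /GRing.scale /= => ->; ring.
apply: alt_intro => [x|c x y|x].
- rewrite contract_ce_diff //; apply: altB; first exact: alt_lie.
  exact/IH/alt_contract.
- rewrite !contract_ce_diff // lie_linl !contract_linl // ce_diff_lin.
  by apply/funext => f; rewrite !fctE /GRing.scale /=; ring.
- rewrite contract_ce_diff // contractB contract_lie // brxx.
  rewrite contract0 //.
  case: m IH s hs ls lie_linl => [|m] IH s hs ls lie_linl.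
    rewrite ce_diff_nil lie_nil; apply/funext => f.
    by rewrite -[LHS]/((0 - 0) - 0 : R^o) !subr0.
  rewrite contract_ce_diff ?contract2 ?ce_diff0 ?subr0 ?subrr //.
  exact: alt_contract.
Qed.

(** By induction, contracting with z: what remains is Jacobi's identity. *)
Lemma lie_comm m x y (s : form m) : altform s ->
  lie x (lie y s) - lie y (lie x s) = lie (br x y) s.
Proof.
elim: m s => [|m IH] s hs; first by rewrite !lie_nil subrr.
have [ls _] := hs.
apply/funext => f; rewrite -(fcons_eta f); move: (f ord0) (fun j => _) => z g.
have /(congr1 (fun t => t g)) E := IH _ (alt_contract z hs).
rewrite -[LHS]/(contract z (lie x (lie y s) - lie y (lie x s)) g).
rewrite -[lie (br x y) s _]/(contract z (lie (br x y) s) g).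
rewrite contractB !contract_lie //; try exact: alt_lie.
rewrite !lieB -br_jacobi [_ - br y (br x z)]addrC -scaleN1r contract_linl // scaleN1r.
by rewrite !fctE -E !fctE; ring.
Qed.

(** By induction, contracting with y: Cartan's formulas reduce the claim to the
    commutator of two Lie derivatives. *)
Lemma ce_diff_lie m x (s : form m) : altform s ->
  ce_diff (lie x s) = lie x (ce_diff s).
Proof.
elim: m s => [|m IH] s hs; first by rewrite lie_nil !ce_diff_nil lie0.
apply/funext => f; rewrite -(fcons_eta f); move: (f ord0) (fun j => _) => y g.
rewrite -[LHS]/(contract y (ce_diff (lie x s)) g).
rewrite -[RHS]/(contract y (lie x (ce_diff s)) g).
rewrite contract_lie; last exact: alt_ce_diff.
rewrite !contract_ce_diff //; last exact: alt_lie.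
rewrite contract_lie // ce_diffB lieB IH; last exact: alt_contract.
by rewrite -(lie_comm x y hs) !fctE; ring.
Qed.

(** By induction: i_x d d = L_x d - d (L_x - d i_x) = (L_x d - d L_x) + d d i_x. *)
Lemma ce_diffK m (s : form m) : altform s -> ce_diff (ce_diff s) = 0.
Proof.
elim: m s => [|m IH] s hs; first by rewrite ce_diff_nil ce_diff0.
apply/funext => f; rewrite -(fcons_eta f); move: (f ord0) (fun j => _) => y g.
rewrite -[LHS]/(contract y (ce_diff (ce_diff s)) g).
rewrite contract_ce_diff; last exact: alt_ce_diff.
rewrite contract_ce_diff // ce_diffB IH; last exact: alt_contract.
by rewrite ce_diff_lie // !fctE; ring.
Qed.

(** [Z] plays the part of the constants, and [G a] of the elements of weight
    [a]. *)
Section Weights.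
Variables (Z : set V) (G : int -> set V).
Hypothesis brZ : forall x z, Z z -> br x z = 0 /\ br z x = 0.
Hypothesis brG : forall a b x y, G a x -> G b y -> G (a + b) (br x y).

Definition vanishing m (s : form m) : Prop := forall i f, Z (f i) -> s f = 0.

(** Only tuples of elements having a weight are constrained. An element may have
    several weights, as zero does below; the condition then forces the form to
    vanish on the tuples containing it. *)
Definition weighted m (w : int) (s : form m) : Prop := forall f (a : 'I_m -> int),
  (forall i, G (a i) (f i)) -> s f != 0 -> \sum_i a i = w.

Lemma vanishing_contract m x (s : form m.+1) : vanishing s -> vanishing (contract x s).
Proof. by move=> vs i f Zf; apply: (vs (lift ord0 i)); rewrite fconsS. Qed.

Lemma vanishing_contract0 m x (s : form m.+1) : vanishing s -> Z x -> contract x s = 0.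
Proof. by move=> vs Zx; apply/funext => f; apply: (vs ord0); rewrite fcons0. Qed.

Lemma vanishing_intro m (s : form m.+1) :
  (forall x, vanishing (contract x s)) -> (forall x, Z x -> contract x s = 0) ->
  vanishing s.
Proof.
move=> h1 h2 i f; rewrite -(fcons_eta f); move: (f ord0) (fun j => _) => x g.
case: (unliftP ord0 i) => [j|] ->; rewrite ?fconsS ?fcons0; first exact: h1.
by move=> Zx; have := congr1 (fun t => t g) (h2 x Zx).
Qed.

Lemma vanishingB m (s t : form m) : vanishing s -> vanishing t -> vanishing (s - t).
Proof. by move=> hs ht i f Zf; rewrite !fctE (hs i) // (ht i) // subrr. Qed.

Lemma weighted_contract m w a x (s : form m.+1) : weighted w s -> G a x ->
  weighted (w - a) (contract x s).
Proof.
move=> ws Gx f b Gf sf.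
rewrite -(ws (fcons x f) (fun k => if unlift ord0 k is Some j then b j else a)) //.
  rewrite big_ord_recl unlift_none addrC addKr.
  by apply: eq_bigr => j _; rewrite liftK.
by move=> i; rewrite /fcons; case: unliftP.
Qed.

Lemma weighted_intro m w (s : form m.+1) :
  (forall a x, G a x -> weighted (w - a) (contract x s)) -> weighted w s.
Proof.
move=> h f a Gf sf; rewrite big_ord_recl.
have := h _ _ (Gf ord0) (fun j => f (lift ord0 j)) (fun j => a (lift ord0 j)).
by rewrite /contract fcons_eta => /(_ (fun _ => Gf _) sf) ->; rewrite addrC subrK.
Qed.

Lemma weightedB m w (s t : form m) : weighted w s -> weighted w t -> weighted w (s - t).
Proof.
move=> hs ht f a Gf; rewrite !fctE; case: (eqVneq (s f) 0) => [-> |sf _]; last exact: hs.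
by rewrite sub0r oppr_eq0; exact: ht.
Qed.

Lemma weighted0 m w : weighted w (0 : form m).
Proof. by move=> f a _; rewrite eqxx. Qed.

Lemma lie_center m x (s : form m) : altform s -> Z x -> lie x s = 0.
Proof.
move=> [ls _] Zx; apply/funext => f; rewrite /lie big1 // => j _.
rewrite (brZ (f j) Zx).2; case: m s ls f j => [|m] s ls f j; first by case: j.
rewrite fnth_cons.
have := congr1 (fun t => t (fnth [seq f a | a <- enum 'I_m.+1 & a != j]))
  (contract0 ls).
by rewrite /contract => ->; rewrite mulr0.
Qed.

Lemma vanishing_lie m x (s : form m) : altform s -> vanishing s -> vanishing (lie x s).
Proof.
elim: m s => [|m IH] s hs vs; first by case.
apply: vanishing_intro => [y|y Zy]; rewrite contract_lie //.
  apply: vanishingB; last exact: vanishing_contract.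
  by apply: IH; [exact: alt_contract|exact: vanishing_contract].
by rewrite (vanishing_contract0 vs) // lie0 (brZ x Zy).1 contract0 ?subr0 //; case: hs.
Qed.

Lemma vanishing_ce_diff m (s : form m) : altform s -> vanishing s ->
  vanishing (ce_diff s).
Proof.
elim: m s => [|m IH] s hs vs; first by rewrite ce_diff_nil => i f.
apply: vanishing_intro => [y|y Zy]; rewrite contract_ce_diff //.
  apply: vanishingB; first exact: vanishing_lie.
  by apply: IH; [exact: alt_contract|exact: vanishing_contract].
by rewrite (vanishing_contract0 vs) // ce_diff0 lie_center // subr0.
Qed.

Lemma weighted_lie m w a x (s : form m) : altform s -> weighted w s -> G a x ->
  weighted (w - a) (lie x s).
Proof.
move=> hs ws Gx; elim: m s w hs ws => [|m IH] s w hs ws.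
  by rewrite lie_nil; exact: weighted0.
apply: weighted_intro => b y Gy; rewrite contract_lie //; apply: weightedB.
  rewrite addrAC; apply: IH; first exact: alt_contract.
  exact: weighted_contract.
rewrite -addrA -opprD; apply: weighted_contract => //; exact: brG.
Qed.

Lemma weighted_ce_diff m w (s : form m) : altform s -> weighted w s ->
  weighted w (ce_diff s).
Proof.
elim: m s w => [|m IH] s w hs ws; first by rewrite ce_diff_nil; exact: weighted0.
apply: weighted_intro => b y Gy; rewrite contract_ce_diff //; apply: weightedB.
  exact: weighted_lie.
apply: IH; first exact: alt_contract.
exact: weighted_contract.
Qed.

End Weights.
End ChevalleyEilenberg.

(** * A basis of the cochains *)

Section AltForms.
Variables (R : comNzRingType) (V : lmodType R).
Local Notation form m := (('I_m -> V) -> R^o).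

Lemma contract_sum m (I : Type) (r : seq I) (c : I -> R) (e : I -> V)
    (s : form m.+1) : multilinear s ->
  contract (\sum_(i <- r) c i *: e i) s = \sum_(i <- r) c i *: contract (e i) s.
Proof.
move=> ls; elim: r => [|i r IH]; last by rewrite !big_cons contract_linl // IH.
by rewrite !big_nil contract0.
Qed.

(** Polarisation in the arguments of indices i and j. *)
Lemma alt_tperm m (s : form m) (i j : 'I_m) f : altform s -> i != j ->
  s (fun k => f (tperm i j k)) = - s f.
Proof.
move=> [ls as_] ij.
pose F x y := fupd (fupd f i x) j y.
have Fi x y : F x y i = x by rewrite /F /fupd (negbTE ij) eqxx.
have Fj x y : F x y j = y by rewrite /F /fupd eqxx.
have FC x y : F x y = fupd (fupd f j y) i x.
  apply/funext => k; rewrite /F /fupd.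
  by case: (eqVneq k j) => // ->; rewrite eq_sym (negbTE ij).
have Fxx x : s (F x x) = 0 by apply: (as_ i j) => //; rewrite Fi Fj.
have F2 x y z : s (F x (y + z)) = s (F x y) + s (F x z).
  by have := ls j (fupd f i x) 1 y z; rewrite scale1r mul1r.
have F1 x y z : s (F (x + y) z) = s (F x z) + s (F y z).
  by rewrite !FC; have := ls i (fupd f j z) 1 x y; rewrite scale1r mul1r.
have fE : f = F (f i) (f j).
  by apply/funext => k; rewrite /F /fupd; do 2?case: eqP => [->|_].
have -> : (fun k => f (tperm i j k)) = F (f j) (f i).
  apply/funext => k; rewrite /F /fupd; case: tpermP => [->|->|/eqP ki /eqP kj].
  - by rewrite (negbTE ij) eqxx.
  - by rewrite eqxx.
  - by rewrite (negbTE ki) (negbTE kj).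
rewrite [in RHS]fE; apply/eqP; rewrite -addr_eq0 addrC; apply/eqP.
by have := Fxx (f i + f j); rewrite F1 !F2 !Fxx add0r addr0.
Qed.

Lemma alt_perm m (s : form m) (p : 'S_m) f : altform s ->
  s (fun k => f (p k)) = (-1) ^+ odd_perm p * s f.
Proof.
move=> hs; have [ts -> /= hts] := prod_tpermP p.
elim: ts hts => [_|[i j] ts IH /= /andP[ij hts]].
  by rewrite big_nil odd_perm1 mul1r; congr s; apply/funext => k; rewrite perm1.
rewrite big_cons odd_mul_tperm ij signr_addb mulN1r mulNr.
set q := (\prod_(t <- ts) _)%g in IH *.
rewrite -IH // -(alt_tperm (fun k => f (q k)) hs ij).
by congr s; apply/funext => k; rewrite permM.
Qed.

End AltForms.

Section Cochains.
Variables (R : realType) (n h : nat).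
Local Notation P := {mpoly R[n]}.
Local Notation form m := (('I_m -> P) -> R^o).

Lemma multilinear_ext m (s t : form m) : multilinear s -> multilinear t ->
  (forall a : 'I_m -> 'X_{1..n},
     s (fun i => 'X_[a i]) = t (fun i => 'X_[a i])) ->
  s = t.
Proof.
elim: m s t => [|m IH] s t ls lt st; apply/funext => f.
  have -> : f = fun i : 'I_0 => 'X_[(fun=> 0%MM) i] by apply/funext; case.
  exact: st.
rewrite -(fcons_eta f); move: (f ord0) (fun i => _) => x g.
suff: contract x s = contract x t by move/(congr1 (fun u => u g)).
rewrite [x]mpolyE !contract_sum //; apply: eq_bigr => a _; congr (_ *: _).
apply: IH => [i {}f c y z|i {}f c y z|b].
- by rewrite /contract -!fupd_fconsS ls.
- by rewrite /contract -!fupd_fconsS lt.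
rewrite /contract.
have -> : fcons 'X_[a] (fun i => 'X_[b i]) =
    (fun i => 'X_[if unlift ord0 i is Some j then b j else a]) :> ('I_m.+1 -> P).
  by apply/funext => i; rewrite /fcons; case: unliftP.
exact: st.
Qed.

Lemma alt_wedge m (z : 'I_m -> P -> R) : (forall a, scalar (z a)) ->
  altform (wedge z : form m).
Proof.
move=> lz; split=> [i f c x y|i j f ij fij]; rewrite /wedge; last first.
  rewrite -det_tr; apply: (determinant_alternate ij) => k.
  by rewrite !mxE fij.
pose M u := \matrix_(a, b) z b (fupd f i u a).
have ME u : \det (\matrix_(a, b) z a (fupd f i u b)) = \det (M u).
  by rewrite -det_tr; congr (\det _); apply/matrixP => a b; rewrite !mxE.
rewrite !ME -[\det (M y)]mul1r.
apply: (@determinant_multilinear _ _ _ _ _ i).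
- by apply/rowP => k; rewrite !mxE !fupd_same lz mul1r.
- apply/matrixP => k l; rewrite !mxE /fupd; congr (z _ _).
  by rewrite eq_sym (negbTE (neq_lift _ _)).
- apply/matrixP => k l; rewrite !mxE /fupd; congr (z _ _).
  by rewrite eq_sym (negbTE (neq_lift _ _)).
Qed.

Definition constant : set P := [set f | exists c, f = c%:MP].

(** A homogeneous polynomial of degree d has the weight d - 2 + h; the zero
    polynomial has every weight. *)
Definition of_weight (a : int) : set P :=
  [set f | forall k, k \in msupp f -> (mdeg k)%:Z - 2 + h%:Z = a].

(** The intrinsic description of the cochains of weight [w]. *)
Definition wform m (w : int) (s : form m) : Prop :=
  [/\ altform s, vanishing constant s & weighted of_weight w s].

Lemma wform_linear m w c (s t : form m) : wform w s -> wform w t ->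
  wform w (c *: s + t).
Proof.
move=> [s1 s2 s3] [t1 t2 t3]; split; first exact: alt_linear.
- by move=> i f Zf; rewrite !fctE (s2 i) // (t2 i) // scaler0 addr0.
- move=> f a Gf; rewrite !fctE; case: (eqVneq (s f) 0) => [->|sf _].
    by rewrite scaler0 add0r; exact: t3.
  exact: (s3 f).
Qed.

Lemma wform0 m w : wform w (0 : form m).
Proof. by split; [exact: alt0 | move=> i f | move=> f a _; rewrite eqxx]. Qed.

Lemma wform_sum m w k (c : 'I_k -> R) (e : 'I_k -> form m) :
  (forall i, wform w (e i)) -> wform w (\sum_i c i *: e i).
Proof.
move=> he; elim/big_ind: _ => [|s t hs ht|i _]; first exact: wform0.
  by rewrite -[s]scale1r; exact: wform_linear.
by rewrite -[_ *: _]addr0; apply: wform_linear => //; exact: wform0.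
Qed.

(** Otherwise the homogeneous component of degree [j] of [f] is zero. *)
Lemma dualS_neq0 j (z : P -> R) f : dualS j z -> z f != 0 ->
  exists2 k, k \in msupp f & mdeg k = j.
Proof.
move=> [lz zj] zf.
have z0 : z 0 = 0.
  by have := lz (-1) 0 0; rewrite scaler0 addr0 mulN1r addNr.
apply: contrapT => hf.
move: zf; rewrite -zj pihomogE big_seq_cond big_pred0 ?z0 ?eqxx // => k.
by apply/negP => /andP[kf /eqP kj]; apply: hf; exists k.
Qed.

(** A nonzero determinant has a nonzero term, given by a permutation [p]; it
    matches the argument [p i] with a functional of the degree that argument
    must then have, so that the weights add up to [w]. *)
Lemma wform_wedge m w (l : seq nat) (z : 'I_m -> P -> R) :
  young l -> size l = m -> \sum_(j <- l) (j%:Z - 2 + h%:Z) = w ->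
  (forall a : 'I_m, dualS (nth 0%N l a) (z a)) -> wform w (wedge z : form m).
Proof.
move=> /andP[_ l0] sl lw dz.
split=> [|i f [c fi]|f a Gf].
- by apply: alt_wedge => a; case: (dz a).
- rewrite /wedge (expand_det_col _ i) big1 // => k _; rewrite mxE.
  have [->|zf] := eqVneq (z k (f i)) 0; first by rewrite mul0r.
  have [u] := dualS_neq0 (dz k) zf.
  rewrite fi msuppC; case: eqP => // _; rewrite inE => /eqP -> /esym.
  rewrite mdeg0 => lk; move: l0; rewrite -lk mem_nth ?sl //.
- rewrite /wedge /determinant => /eqP.
  case: (pselect (exists p : 'S_m, forall i, z i (f (p i)) != 0)) => [[p hp] _|hp];
    last first.
    case; apply: big1 => p _; rewrite [X in _ * X](_ : _ = 0) ?mulr0 //.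
    apply/eqP; rewrite prodf_seq_eq0; apply/hasP.
    have /existsP[i zi] : [exists i, z i (f (p i)) == 0].
      apply: contrapT => H; apply: hp; exists p => i.
      by apply/negP => zi; apply: H; apply/existsP; exists i.
    by exists i; rewrite ?mem_index_enum //= mxE.
  rewrite (reindex_inj (@perm_inj _ p)) /= -lw (big_nth 0%N) sl big_mkord.
  apply: eq_bigr => i _.
  have [k kf <-] := dualS_neq0 (dz i) (hp i).
  by rewrite (Gf (p i) k kf).
Qed.

Lemma cochains_wform m w (s : form m) : cochains h m w s -> wform w s.
Proof.
move=> [k [c [e [he ->]]]]; apply: wform_sum => i.
by have [l [z [yl sl lw dz ->]]] := he i; exact: (wform_wedge yl sl lw dz).
Qed.

(** The bound [D] on the degrees makes the monomials a finite type; the weight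
    bounds the degrees that occur, so that a large enough [D] covers them all. *)
Section Basis.
Variables (m D : nat).
Local Notation T := 'X_{1..n < D}.

(** Sorted by non-increasing degree, as the rows of a Young diagram are. *)
Definition mons (A : {set T}) : seq 'X_{1..n} :=
  sort (fun a b => mdeg b <= mdeg a)%N [seq bmnm a | a <- enum A].

Definition mon (A : {set T}) (i : 'I_m) : 'X_{1..n} := nth 0%MM (mons A) i.

Definition mon_tuple (A : {set T}) : 'I_m -> P := fun i => 'X_[mon A i].

Definition mon_wedge (A : {set T}) : form m := wedge (fun i f => f@_(mon A i)).

Lemma size_mons (A : {set T}) : size (mons A) = #|A|.
Proof. by rewrite size_sort size_map cardE. Qed.

Lemma uniq_mons (A : {set T}) : uniq (mons A).
Proof. by rewrite sort_uniq map_inj_uniq ?enum_uniq //; exact: val_inj. Qed.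

Lemma mem_mons (A : {set T}) (a : T) : (bmnm a \in mons A) = (a \in A).
Proof. by rewrite mem_sort mem_map ?mem_enum //; exact: val_inj. Qed.

Lemma mem_mons_val (A : {set T}) k : k \in mons A -> exists2 a : T, a \in A & k = bmnm a.
Proof. by rewrite mem_sort => /mapP[a]; rewrite mem_enum; exists a. Qed.

Lemma mon_in (A : {set T}) i : #|A| = m -> mon A i \in mons A.
Proof. by move=> Am; rewrite mem_nth // size_mons Am. Qed.

Lemma mon_inj (A : {set T}) : #|A| = m -> injective (mon A).
Proof.
move=> Am i j /eqP; rewrite nth_uniq ?uniq_mons ?size_mons ?Am // => /eqP.
exact: val_inj.
Qed.

(** If A and B differ, some monomial of B is not in A and its column in the
    determinant is zero. *)
Lemma mon_wedgeE (A B : {set T}) : #|A| = m -> #|B| = m ->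
  mon_wedge A (mon_tuple B) = (A == B)%:R.
Proof.
move=> Am Bm; rewrite /mon_wedge /wedge /mon_tuple.
case: eqVneq => [<-|AB].
  rewrite -[RHS](det1 R m); congr (\det _); apply/matrixP => i j.
  by rewrite !mxE mcoeffX (inj_eq (mon_inj Am)) eq_sym.
have /fintype.subsetPn[b bB bA] : ~~ (B \subset A).
  by apply: contraNN AB => BA; rewrite eq_sym eqEcard BA Am Bm /=.
have bmem : bmnm b \in mons B by rewrite mem_mons.
have lt : (index (bmnm b) (mons B) < m)%N by rewrite -[X in (_ < X)%N]Bm -size_mons index_mem.
pose i0 := Ordinal lt.
have monb : mon B i0 = bmnm b by rewrite /mon nth_index.
rewrite (expand_det_col _ i0) big1 // => k _; rewrite mxE mcoeffX monb.
case: eqP => [E|_]; last by rewrite mul0r.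
by move: bA; rewrite -mem_mons E mon_in.
Qed.

Variable w : int.

(** The monomial 1 is excluded because cochains vanish on constants. *)
Definition mon_sets : {set {set T}} :=
  [set A : {set T} | [&& #|A| == m, [forall a in A, (0 < mdeg (bmnm a))%N] &
    \sum_(a in A) ((mdeg (bmnm a))%:Z - 2 + h%:Z) == w]]%SET.

Lemma mon_wedge_generator (A : {set T}) : A \in mon_sets ->
  exists (l : seq nat) (z : 'I_m -> P -> R),
    [/\ young l, size l = m, \sum_(j <- l) (j%:Z - 2 + h%:Z) = w,
        forall a : 'I_m, dualS (nth 0%N l a) (z a) & mon_wedge A = wedge z].
Proof.
rewrite inE => /and3P[/eqP Am /forall_inP A0 /eqP Aw].
exists [seq mdeg k | k <- mons A], (fun i f => f@_(mon A i)); split => //.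
- apply/andP; split.
    rewrite sorted_map; apply: (@sort_sorted _ (fun a b => (mdeg b <= mdeg a)%N)).
    by move=> a b; exact: leq_total.
  apply/mapP => -[k /mem_mons_val[a /A0 a0 ->] /esym a0'].
  by rewrite a0' in a0.
- by rewrite size_map size_mons.
- rewrite big_map (perm_big [seq bmnm a | a <- enum A]) /=.
    by rewrite big_map big_enum.
  exact/permPl/perm_sort.
- move=> i; rewrite (nth_map 0%MM) ?size_mons ?Am //; split.
    by move=> c x y; rewrite mcoeffD mcoeffZ.
  move=> f; rewrite -/(mon A i); set k := mon A i.
  rewrite pihomogE linear_sum /= [in RHS](mpolyE f) linear_sum /=.
  rewrite big_mkcond /=; apply: eq_bigr => u _; rewrite !mcoeffZ mcoeffX.
  by case: (eqVneq u k) => [->|]; rewrite ?eqxx // mulr0 if_same.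
Qed.

Hypothesis DP : (absz (w + (2 - h%:Z) * m%:Z)%R < D)%N.

(** It suffices to look at tuples of monomials. If such a tuple is not injective,
    contains 1 or has the wrong weight then the form vanishes on it; otherwise it
    is a permutation of the tuple of its set of entries. *)
Lemma wform_eq0 (s : form m) : wform w s ->
  (forall A, A \in mon_sets -> s (mon_tuple A) = 0) -> s = 0.
Proof.
move=> [as_ vs ws] s0; apply: multilinear_ext => [||a].
- by case: as_.
- by case: (@alt0 R P m).
rewrite [RHS]/0 /=.
have [//|sa] := eqVneq (s (fun i => 'X_[a i])) 0.
exfalso.
have inja : injective a.
  move=> i j aij; apply/eqP; apply: contraNT sa => ij.
  by apply/eqP; case: as_ => _ /(_ i j _ ij); apply; rewrite aij.
have a0 i : (0 < mdeg (a i))%N.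
  rewrite lt0n mdeg_eq0; apply: contraNN sa => /eqP ai.
  by apply/eqP/(vs i); exists 1; rewrite ai mpolyX0.
have aw : \sum_i ((mdeg (a i))%:Z - 2 + h%:Z) = w.
  apply: (ws (fun i => 'X_[a i])) => // i k.
  by rewrite msuppX inE => /eqP ->.
have aD i : (mdeg (a i) < D)%N.
  have E : \sum_i ((mdeg (a i))%:Z - 2 + h%:Z) =
           \sum_i (mdeg (a i))%:Z - (2 - h%:Z) * m%:Z.
    transitivity (\sum_i ((mdeg (a i))%:Z - (2 - h%:Z))).
      by apply: eq_bigr => j _; rewrite opprB -addrA [- 2 + _]addrC.
    by rewrite sumrB sumr_const card_ord -[_ *+ m]mulr_natr natz.
  apply: leq_ltn_trans DP; rewrite -aw E subrK.
  have : (mdeg (a i))%:Z <= \sum_i (mdeg (a i))%:Z.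
    by rewrite (bigD1 i) //= lerDl sumr_ge0.
  move: (\sum_i _) (mdeg _) => S d; lia.
pose b i : T := BMultinom (aD i).
have injb : injective b by move=> i j /(congr1 (@bmnm _ _)) /inja.
pose A : {set T} := [set b i | i : 'I_m]%SET.
have Am : #|A| = m by rewrite card_imset // card_ord.
have AI : A \in mon_sets.
  rewrite inE Am eqxx /=; apply/andP; split.
    by apply/forall_inP => _ /imsetP[i _ ->]; exact: a0.
  rewrite big_imset /=; last by move=> i j _ _; exact: injb.
  by rewrite aw.
have [j hj] : exists j : 'I_m -> 'I_m, forall i, a i = mon A (j i).
  have ex i : exists j, a i == mon A j.
    have : a i \in mons A by rewrite -[a i]/(bmnm (b i)) mem_mons imset_f.
    move=> ain; have lt : (index (a i) (mons A) < m)%N.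
      by rewrite -[X in (_ < X)%N]Am -size_mons index_mem.
    by exists (Ordinal lt); rewrite /mon nth_index.
  by exists (fun i => xchoose (ex i)) => i; apply/eqP/(xchooseP (ex i)).
have injj : injective j by move=> i i' jj; apply: inja; rewrite !hj jj.
move: sa; have -> : (fun i => 'X_[a i]) = (fun i => mon_tuple A (perm injj i)).
  by apply/funext => i; rewrite permE /mon_tuple hj.
by rewrite alt_perm // s0 // mulr0 eqxx.
Qed.

Lemma wform_expand (s : form m) : wform w s ->
  s = \sum_(A in mon_sets) s (mon_tuple A) *: mon_wedge A.
Proof.
move=> hs; apply/eqP; rewrite -subr_eq0 -[s in s - _]scale1r addrC; apply/eqP.
have cardI B : B \in mon_sets -> #|B| = m by rewrite inE => /and3P[/eqP].
have hw : wform w (- \sum_(A in mon_sets) s (mon_tuple A) *: mon_wedge A).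
  rewrite -sumrN; elim/big_ind: _ => [|t u ht hu|A AI]; first exact: wform0.
    by rewrite -[t]scale1r; exact: wform_linear.
  rewrite -scaleNr -[_ *: _]addr0; apply: wform_linear; last exact: wform0.
  by have [l [z [yl sl lw dz ->]]] := mon_wedge_generator AI; apply: (wform_wedge yl).
apply: wform_eq0 => [|B BI]; first by rewrite addrC; exact: wform_linear.
rewrite !fctE fct_sumE scale1r (bigD1 B) //= fctE mon_wedgeE ?cardI // eqxx.
rewrite big1 ?addr0 => [|A /andP[AI AB]].
  by rewrite /GRing.scale /= mulr1 addNr.
by rewrite fctE mon_wedgeE ?cardI // (negbTE AB) /GRing.scale /= mulr0.
Qed.

End Basis.

(** The sum of the degrees of m monomials of total weight [w] is
    w + (2 - h) m. *)
Definition mon_bound m (w : int) : nat := (absz (w + (2 - h%:Z) * m%:Z)%R).+1.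

Definition dimC m (w : int) : nat := #|mon_sets m (mon_bound m w) w|.

Definition mon_index m w := mon_sets m (mon_bound m w) w.

Lemma mon_index_card m w A : A \in mon_index m w -> #|A| = m.
Proof. by rewrite inE => /and3P[/eqP]. Qed.

Definition mon_basis m w (i : 'I_(dimC m w)) : form m :=
  mon_wedge (enum_val (i : 'I_#|mon_index m w|)).

Lemma mon_basis_expand m w (s : form m) : wform w s ->
  s = \sum_i s (mon_tuple (enum_val (i : 'I_#|mon_index m w|))) *: mon_basis i.
Proof. by move=> hs; rewrite {1}(wform_expand (ltnSn _) hs) big_enum_val. Qed.

Lemma cochainsE m w (s : form m) : cochains h m w s <-> wform w s.
Proof.
split=> [|hs]; first exact: cochains_wform.
exists (dimC m w), (fun i => s (mon_tuple (enum_val (i : 'I_#|mon_index m w|)))).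
exists (@mon_basis m w); split; last exact: mon_basis_expand.
by move=> i; apply: mon_wedge_generator; exact: enum_valP.
Qed.

Lemma cochains_basis m w :
  quotient_basis (cochains h m w) [set 0] (@mon_basis m w).
Proof.
split=> [i|s /cochainsE hs].
  exists 1%N, (fun=> 1), (fun=> mon_basis i); split; last by rewrite big_ord1 scale1r.
  by move=> _; apply: mon_wedge_generator; exact: enum_valP.
exists (\row_i s (mon_tuple (enum_val (i : 'I_#|mon_index m w|)))); split.
  apply/eqP; rewrite subr_eq0 {1}(mon_basis_expand hs); apply/eqP.
  by apply: eq_bigr => i _; rewrite mxE.
move=> c /eqP; rewrite subr_eq0 => /eqP sE; apply/rowP => j; rewrite mxE sE.
have cI (i : 'I_(dimC m w)) := mon_index_card (enum_valP (i : 'I_#|mon_index m w|)).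
rewrite fct_sumE (bigD1 j) //= fctE /mon_basis mon_wedgeE ?cI // eqxx big1 ?addr0.
  by rewrite /GRing.scale /= mulr1.
move=> i ij; rewrite fctE /mon_basis mon_wedgeE ?cI // (inj_eq enum_val_inj) (negbTE ij).
by rewrite /GRing.scale /= mulr0.
Qed.

End Cochains.

(** * The Poisson bracket and the coboundary *)

Section Bracket.
Variables (R : realType) (n h : nat) (p : 'M[{mpoly R[n]}]_n).
Local Notation P := {mpoly R[n]}.
Local Notation form m := (('I_m -> P) -> R^o).
Local Notation br := (pbracket p).

Lemma pbracket_linr c (x y z : P) : br x (c *: y + z) = c *: br x y + br x z.
Proof.
rewrite /pbracket scaler_sumr -big_split; apply: eq_bigr => i _ /=.
rewrite scaler_sumr -big_split; apply: eq_bigr => j _ /=.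
by rewrite mderivD mderivZ mulrDr scalerAr.
Qed.

Lemma pbracket_linl c (x y z : P) : br (c *: x + y) z = c *: br x z + br y z.
Proof.
rewrite /pbracket scaler_sumr -big_split; apply: eq_bigr => i _ /=.
rewrite scaler_sumr -big_split; apply: eq_bigr => j _ /=.
by rewrite mderivD mderivZ mulrDr mulrDl -scalerAr -scalerAl.
Qed.

Lemma pbracket_constant (x z : P) : constant z -> br x z = 0 /\ br z x = 0.
Proof.
move=> [c ->]; split; rewrite /pbracket big1 // => i _; rewrite big1 // => j _.
  by rewrite mderivC mulr0.
by rewrite mderivC mulr0 mul0r.
Qed.

Lemma msupp_mderiv i (f : P) k : k \in msupp (mderiv i f) -> (k + U_(i))%MM \in msupp f.
Proof.
rewrite !mcoeff_msupp mcoeff_mderiv; apply: contraNN => /eqP ->.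
by rewrite mul0rn.
Qed.

Lemma msupp_sum (I : finType) (F : I -> P) k : k \in msupp (\sum_i F i) ->
  exists i, k \in msupp (F i).
Proof.
move=> kF; apply: contrapT => H; move: kF; rewrite mcoeff_msupp raddf_sum big1 ?eqxx //=.
by move=> i _; apply/eqP; apply: contrapT => /negP; rewrite -mcoeff_msupp => ki; apply: H; exists i.
Qed.

Hypothesis hp : homogeneous_poisson h p.

(** Each term p_ij d_i x d_j y of the bracket adds h to the sum of the degrees
    and loses 2 by differentiation, hence the weights d - 2 + h add up. *)
Lemma pbracket_of_weight a b (x y : P) : of_weight h a x -> of_weight h b y ->
  of_weight h (a + b) (br x y).
Proof.
move=> wx wy k /msupp_sum[i /msupp_sum[j]].
move=> /msuppM_le/allpairsP[[u v] /= [/msuppM_le/allpairsP[[t {}u] /= [tp ux ->]] vy ->]].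
have [_ /(_ i j) /dhomogP /(_ t tp) /= ht _] := hp.
have := wx _ (msupp_mderiv ux); have := wy _ (msupp_mderiv vy).
rewrite !mdegD !mdeg1 ht; lia.
Qed.

Lemma pbracket_anti (x y : P) : br x y = - br y x.
Proof.
have [anti _ _] := hp.
rewrite /pbracket exchange_big -sumrN; apply: eq_bigr => i _.
rewrite -sumrN; apply: eq_bigr => j _.
by rewrite anti !mulNr mulrAC.
Qed.

Lemma pbracketxx (x : P) : br x x = 0.
Proof.
have /eqP := pbracket_anti x x; rewrite -addr_eq0 -mulr2n -scaler_nat scaler_eq0.
by rewrite pnatr_eq0 /= => /eqP.
Qed.

Lemma pbracketNr (x y : P) : br x (- y) = - br x y.
Proof.
have := pbracket_linr (-1) x y 0; have := pbracket_constant x (ex_intro _ 0 erefl).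
by rewrite mpolyC0 => -[-> _]; rewrite !addr0 !scaleN1r.
Qed.

Lemma pbracket_jacobi (x y z : P) : br x (br y z) - br y (br x z) = br (br x y) z.
Proof.
have [_ _ /(_ x y z)] := hp; rewrite (pbracket_anti z x) pbracketNr.
by rewrite (pbracket_anti z) => /eqP; rewrite subr_eq0 => /eqP.
Qed.

Lemma wform_coboundary m w (s : form m) : wform h w s -> wform h w (coboundary p s).
Proof.
move=> [as_ vs ws]; split.
- exact: (alt_ce_diff pbracket_linr pbracket_linl pbracketxx).
- by apply: (vanishing_ce_diff pbracket_constant).
- by apply: (weighted_ce_diff pbracket_of_weight).
Qed.

Lemma coboundaryK m w (s : form m) : wform h w s -> coboundary p (coboundary p s) = 0.
Proof.
move=> [as_ _ _].
exact: (ce_diffK pbracket_linr pbracket_linl pbracket_jacobi pbracketxx as_).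
Qed.

Lemma coboundary_lin m c (s t : form m) :
  coboundary p (c *: s + t) = c *: coboundary p s + coboundary p t.
Proof. exact: ce_diff_lin. Qed.

End Bracket.

(** * The Euler-Poincare formula *)

(** Two subspaces of V are given in coordinates, as the images under [phi] of the
    row spaces of K and L. *)
Section QuotientRank.
Variables (R : realType) (V : lmodType R) (N : nat) (phi : {linear 'rV[R]_N -> V}).
Hypothesis phi_inj : injective phi.
Variables (a b : nat) (K : 'M[R]_(a, N)) (L : 'M[R]_(b, N)) (Z B : set V).
Hypothesis LK : (L <= K)%MS.
Hypothesis ZE : forall z, Z z <-> exists2 u, (u <= K)%MS & z = phi u.
Hypothesis BE : forall z, B z <-> exists2 u, (u <= L)%MS & z = phi u.

Lemma sub_comb_coord k (U : 'M[R]_(k, N)) (e : 'I_k -> V) z (c : 'rV_k) :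
  (forall i, e i = phi (row i U)) ->
  phi z - \sum_i c 0 i *: e i = phi (z - c *m U).
Proof.
move=> eU; have -> : \sum_i c 0 i *: e i = phi (c *m U).
  rewrite mulmx_sum_row linear_sum.
  by apply: eq_bigr => i _; rewrite linearZ eU.
by rewrite -linearB.
Qed.

Lemma mem_B_coord v : B (phi v) <-> (v <= L)%MS.
Proof.
split=> [/BE[u uL /phi_inj ->//]|vL]; apply/BE; by exists v.
Qed.

(** In coordinates, a basis of Z / B is a free family of rows spanning a
    complement of the row space of L in that of K. In particular all bases have
    the same size, as the definition of [quotient_dim] requires. *)
Lemma quotient_basis_rank k (e : 'I_k -> V) : quotient_basis Z B e ->
  k = (\rank K - \rank L)%N.
Proof.
move=> [Ze bas].
have /choice[u hu] : forall i, exists u : 'rV_N, (u <= K)%MS /\ e i = phi u.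
  by move=> i; have /ZE[u uK ->] := Ze i; exists u.
pose U := \matrix_i u i.
have eU i : e i = phi (row i U) by rewrite rowK; case: (hu i).
have UK : (U <= K)%MS by apply/row_subP => i; rewrite rowK; case: (hu i).
have ind (c : 'rV_k) : (c *m U <= L)%MS -> c = 0.
  move=> cL; have Z0 : Z (phi 0) by apply/ZE; exists 0; rewrite ?sub0mx.
  have [c0 [_ uniq]] := bas _ Z0.
  transitivity c0; first symmetry; apply: uniq; rewrite (sub_comb_coord _ _ eU); apply/mem_B_coord.
    by rewrite sub0r eqmx_opp.
  by rewrite mul0mx subr0 sub0mx.
have freeU : row_free U.
  rewrite -kermx_eq0; apply/rowV0P => c /sub_kermxP cU; apply: ind.
  by rewrite cU sub0mx.
have cap0 : (U :&: L)%MS = 0.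
  apply/eqP/rowV0P => v; rewrite sub_capmx => /andP[/submxP[c ->]] /ind ->.
  by rewrite mul0mx.
have sumK : (U + L :=: K)%MS.
  apply/eqmxP; rewrite addsmx_sub UK LK /=; apply/row_subP => i.
  have Zi : Z (phi (row i K)) by apply/ZE; exists (row i K); rewrite ?row_sub.
  have [c [hc _]] := bas _ Zi.
  move: hc; rewrite (sub_comb_coord _ _ eU) => /mem_B_coord hc.
  rewrite -[row i K](subrK (c *m U)) addrC addmx_sub_adds ?submxMl //.
have := mxrank_sum_cap U L; rewrite cap0 mxrank0 addn0 sumK => ->.
by rewrite addnK; apply/esym/eqP.
Qed.

Lemma quotient_basis_exists :
  exists e : 'I_(\rank (K :\: L)) -> V, quotient_basis Z B e.
Proof.
pose U := row_base (K :\: L)%MS.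
exists (fun i => phi (row i U)).
have UK : (U <= K)%MS by rewrite eq_row_base diffmxSl.
have hU i : phi (row i U) = phi (row i U) by [].
split=> [i|z /ZE[v vK ->]].
  by apply/ZE; exists (row i U) => //; exact: submx_trans (row_sub _ _) UK.
have : (v <= K :\: L + K :&: L)%MS by rewrite addsmx_diff_cap_eq.
case/sub_addsmxP => -[v1 v2] /= vE.
have /submxP[c cE] : (v1 *m (K :\: L)%MS <= U)%MS by rewrite eq_row_base submxMl.
exists c; split.
  rewrite (sub_comb_coord _ _ hU); apply/mem_B_coord.
  by rewrite vE cE addrC addKr; apply: submx_trans (submxMl _ _) (capmxSr _ _).
move=> c'; rewrite (sub_comb_coord _ _ hU) => /mem_B_coord hc'.
apply/eqP; rewrite -subr_eq0; apply/eqP.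
have : ((c - c') *m U <= (K :\: L) :&: L)%MS.
  rewrite sub_capmx (submx_trans (submxMl _ _)) ?eq_row_base //=.
  have -> : (c - c') *m U = (v - c' *m U) - v2 *m (K :&: L)%MS.
    by rewrite vE cE mulmxBl addrAC [_ + _ - v2 *m _]addrK.
  apply: addmx_sub => //; rewrite eqmx_opp.
  by apply: submx_trans (submxMl _ _) (capmxSr _ _).
rewrite capmx_diff submx0 => /eqP cU.
by apply: (row_free_inj (row_base_free (K :\: L)%MS)); rewrite mul0mx.
Qed.

Lemma quotient_dim_rank : quotient_dim Z B = (\rank K - \rank L)%N.
Proof.
apply: xget_unique => [|k [e he]]; last exact: quotient_basis_rank he.
have [e he] := quotient_basis_exists.
by rewrite /= -(quotient_basis_rank he); exists e.
Qed.

End QuotientRank.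

Section Complex.
Variables (R : realType) (V : nat -> lmodType R) (C : forall m, set (V m)).
Variables (d : forall m, V m -> V m.+1) (c : nat -> nat).
Variable e : forall m, 'I_(c m) -> V m.
Arguments C : clear implicits.
Hypothesis d_linear : forall m k (s t : V m), d (k *: s + t) = k *: d s + d t.
Hypothesis C_basis : forall m, quotient_basis (C m) [set 0] (@e m).
Hypothesis C_sum : forall m (u : 'rV_(c m)), C m (\sum_i u 0 i *: e i).
Hypothesis dC : forall m s, C m s -> C m.+1 (d s).
Hypothesis ddC : forall m s, C m s -> d (d s) = 0.

Definition complex_cocycles m : set (V m) := C m `&` [set s | d s = 0].

Arguments complex_cocycles : clear implicits.

Definition complex_coboundaries m : set (V m) :=
  match m with 0%N => [set 0] | m'.+1 => @d m' @` C m' end.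

Arguments complex_coboundaries : clear implicits.

Definition complex_dimH m : nat :=
  quotient_dim (complex_cocycles m) (complex_coboundaries m).

(** [r m] is the rank of the differential that starts in degree m. *)
Lemma rank_nullity_complex : exists r : nat -> nat,
  [/\ forall m, (r m <= c m)%N, complex_dimH 0 = (c 0 - r 0)%N &
     forall m, (complex_dimH m.+1)%:Z = (c m.+1)%:Z - (r m.+1)%:Z - (r m)%:Z].
Proof.
pose f m (u : 'rV[R]_(c m)) : V m := \sum_i u 0 i *: e i.
have flin m : linear (f m).
  move=> k u v; rewrite /f scaler_sumr -big_split; apply: eq_bigr => i _ /=.
  by rewrite !mxE scalerDl scalerA.
pose phi m : {linear 'rV[R]_(c m) -> V m} :=
  HB.pack (f m) (GRing.isLinear.Build _ _ _ _ (f m) (flin m)).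
have coordP m s : C m s -> exists u, s = phi m u.
  move=> /(C_basis m).2[u [/eqP]]; rewrite subr_eq0 => /eqP -> _.
  by exists u.
have phi_inj m : injective (phi m).
  move=> u v uv; have [w [_ uniq]] := (C_basis m).2 _ (C_sum u).
  transitivity w; first symmetry; apply: uniq; first exact: subrr.
  by apply/eqP; rewrite subr_eq0; apply/eqP.
have d0 m : d (0 : V m) = 0.
  by have := d_linear (-1) (0 : V m) 0; rewrite scaler0 addr0 scaleN1r addNr.
have exD m : exists D : 'M[R]_(c m, c m.+1), forall u, d (phi m u) = phi m.+1 (u *m D).
  have /choice[g hg] : forall i : 'I_(c m), exists u, d (e i) = phi m.+1 u.
    by move=> i; apply/coordP/dC; case: (C_basis m).
  exists (\matrix_i g i) => u; rewrite mulmx_sum_row linear_sum.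
  have dsum (I : Type) (r : seq I) (k : I -> R) (s : I -> V m) :
     d (\sum_(i <- r) k i *: s i) = \sum_(i <- r) k i *: d (s i).
    by elim: r => [|i r IH]; rewrite ?big_nil ?big_cons ?d0 // d_linear IH.
  by rewrite [LHS]dsum; apply: eq_bigr => i _; rewrite linearZ rowK -hg.
pose D m := projT1 (cid (exD m)).
have hD m : forall u, d (phi m u) = phi m.+1 (u *m D m) := projT2 (cid (exD m)).
have DD m : D m *m D m.+1 = 0.
  apply/row_matrixP => i; rewrite row0 row_mul -[row i _]mul1mx; apply: (phi_inj m.+2).
  rewrite linear0 -hD -[1%:M *m _]/(1%:M *m _) mul1mx rowE -hD ddC //; exact: C_sum.
have cycE m z : complex_cocycles m z <-> exists2 u, (u <= kermx (D m))%MS & z = phi m u.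
  split=> [[/coordP[u ->] /= ]|[u /sub_kermxP uD ->]].
    rewrite hD -(linear0 (phi m.+1)) => /phi_inj uD; exists u => //.
    exact/sub_kermxP.
  by split; [exact: C_sum | rewrite /= hD uD linear0].
exists (fun m => \rank (D m)); split=> [m||m].
- exact: rank_leq_row.
- rewrite /complex_dimH (@quotient_dim_rank _ _ _ (phi 0%N) (phi_inj 0%N) _ _
    (kermx (D 0%N)) (0 : 'M_(c 0%N))) ?sub0mx ?mxrank_ker ?mxrank0 ?subn0 //.
  move=> z; split=> [->|[u]]; first by exists 0; rewrite ?sub0mx ?linear0.
  by rewrite submx0 => /eqP -> ->; rewrite linear0.
- have DK : (D m <= kermx (D m.+1))%MS by apply/sub_kermxP.
  have := mxrankS DK; have := rank_leq_row (D m.+1).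
  rewrite /complex_dimH (@quotient_dim_rank _ _ _ (phi m.+1) (phi_inj m.+1) _ _
    (kermx (D m.+1)) (D m)) ?mxrank_ker //; first lia.
  move=> z; split=> [[s /coordP[u ->] <-]|[u /submxP[v ->] ->]].
    by exists (u *m D m); rewrite ?submxMl.
  by exists (phi m v); [exact: C_sum|].
Qed.

(** The ranks telescope in the alternating sum. *)
Theorem euler_poincare M : (forall m, (M <= m)%N -> c m = 0%N) ->
  \sum_(m < M) (-1) ^+ m * (complex_dimH m)%:Z = \sum_(m < M) (-1) ^+ m * (c m)%:Z
  /\ forall m, (M <= m)%N -> complex_dimH m = 0%N.
Proof.
move=> cM; have [r [rc H0 HS]] := rank_nullity_complex.
have main k : \sum_(m < k.+1) (-1) ^+ m * (complex_dimH m)%:Z =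
   \sum_(m < k.+1) (-1) ^+ m * (c m)%:Z - (-1) ^+ k * (r k)%:Z.
  elim: k => [|k IH]; first by rewrite !big_ord1 !expr0 !mul1r H0 subzn.
  rewrite big_ord_recr /= IH [in RHS]big_ord_recr /= HS exprS; ring.
have HM m : (M <= m)%N -> complex_dimH m = 0%N.
  move=> Mm; have := cM _ Mm; case: m Mm => [|m] Mm cm; first by rewrite H0 cm.
  have := HS m; rewrite cm; lia.
split => //; case: M cM HM => [|M] cM HM; first by rewrite !big_ord0.
have := main M.+1; rewrite big_ord_recr [in RHS]big_ord_recr /= HM // cM //.
have := rc M.+1; rewrite cM // leqn0 => /eqP ->.
by rewrite !mulr0 !addr0.
Qed.

End Complex.

(** * Young diagrams *)

Section Young.

Lemma mem_leq_sumn (l : seq nat) j : j \in l -> (j <= sumn l)%N.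
Proof.
elim: l => //= x l IH; rewrite inE => /orP[/eqP ->|/IH]; first exact: leq_addr.
by move/leq_trans; apply; exact: leq_addl.
Qed.

Lemma rows_eq0 (l : seq nat) j : (sumn l < j)%N -> rows l j = 0%N.
Proof.
move=> lj; apply/count_memPn; apply/negP => /mem_leq_sumn.
by rewrite leqNgt lj.
Qed.

Lemma finite_nabla A m : finite_set (nabla A m).
Proof.
pose D := (absz A).+1; pose k := absz m.
apply: (@sub_finite_set _ _ ((fun t : k.-tuple 'I_D => map val t) @` setT)).
  move=> l [_ lm lA].
  have sl : size l == k by rewrite /k -lm.
  exists (map_tuple inord (Tuple sl)) => //=.
  rewrite -map_comp -[RHS]map_id; apply/eq_in_map => j jl /=.
  by rewrite inordK // ltnS /D -lA /= mem_leq_sumn.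
exact/finite_image/finite_finset.
Qed.

Lemma young_rcons1 l : young (rcons l 1%N) = young l.
Proof.
rewrite /young mem_rcons inE /=.
have E s : sorted geq s = sorted leq (rev s) by rewrite rev_sorted.
rewrite !E rev_rcons /= path_sortedE; last exact: leq_trans.
rewrite all_rev; case: (boolP (0%N \in l)) => l0; rewrite ?andbF //= !andbT.
rewrite [all _ _](_ : _ = true) //; apply/allP => x xl; rewrite lt0n.
by apply: contraNneq l0 => <-.
Qed.

Lemma young_mapS l : young (map S l) = sorted geq l.
Proof.
rewrite /young sorted_map; have -> : 0%N \notin map S l by apply/mapP => -[].
by rewrite andbT.
Qed.

Lemma young_last1 l : young l -> 1%N \in l -> exists2 l', young l' & l = rcons l' 1%N.
Proof.
case/lastP: l => // l x yl xl; suff E : x = 1%N.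
  by exists l; rewrite ?E //; move: yl; rewrite E young_rcons1.
move: yl xl => /andP[]; rewrite -[sorted _ _](rev_sorted leq) rev_rcons /=.
rewrite path_sortedE; last exact: leq_trans.
rewrite all_rev => /andP[/allP ax _]; rewrite !mem_rcons !inE negb_or.
move=> /andP[x0 _] /orP[/eqP //|/ax]; lia.
Qed.

Lemma sumn_mapS l : sumn (map S l) = (sumn l + size l)%N.
Proof. by elim: l => //= x l ->; rewrite !addSn !addnS addnA. Qed.

Lemma sumn_rcons1 l : sumn (rcons l 1%N) = (sumn l).+1.
Proof. by rewrite sumn_rcons addn1. Qed.

(** As the rows are in non-increasing order, a row of length 1 is the last one;
    and if there is none, then one cell can be removed from each row. *)
Lemma nabla_split (A : int) (m : nat) :
  nabla A m%:Z = (fun l => rcons l 1%N) @` nabla (A - 1) (m%:Z - 1)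
    `|` map S @` nabla (A - m%:Z) m%:Z.
Proof.
apply/seteqP; split=> [l [yl lm lA]|l [[l' [yl lm lA] <-]|[l' [yl lm lA] <-]]].
- have [l1|l1] := boolP (1%N \in l).
    left; have [l' yl' E] := young_last1 yl l1; exists l' => //.
    move: lm lA; rewrite E size_rcons sumn_rcons1 => lm lA; split=> //; lia.
  right; exists (map predn l).
    have /andP[sl l0] := yl.
    have lE : map S (map predn l) = l.
      rewrite -map_comp -[RHS]map_id; apply/eq_in_map => x xl /=.
      by rewrite prednK // lt0n; apply: contraNneq l0 => <-.
    split; last 2 first.
    + by rewrite size_map.
    + by move: lA lm; rewrite -{1}lE sumn_mapS size_map; lia.
    apply/andP; split; first by rewrite -young_mapS lE.
    apply/mapP => -[x xl x0].
    have : x = 0%N \/ x = 1%N by lia.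
    by case=> xE; rewrite xE in xl; [rewrite xl in l0 | rewrite xl in l1].
  have /andP[_ l0] := yl.
  rewrite -map_comp -[RHS]map_id; apply/eq_in_map => x xl /=.
  by rewrite prednK // lt0n; apply: contraNneq l0 => <-.
- split; first by rewrite young_rcons1.
  + by rewrite size_rcons -addn1 PoszD lm subrK.
  + by rewrite sumn_rcons1 -addn1 PoszD lA subrK.
- split; first by rewrite young_mapS; case/andP: yl.
  + by rewrite size_map.
  + by rewrite sumn_mapS PoszD lA lm subrK.
Qed.

Lemma nabla_split_disjoint (A B m : int) :
  (fun l => rcons l 1%N) @` nabla A m `&` map S @` nabla B (m + 1) = set0.
Proof.
apply/seteqP; split=> // l [[l1 _ <-] [l2 [/andP[_ l20] _ _] E]].
have : 1%N \in map S l2 by rewrite E mem_rcons inE eqxx.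
by case/mapP => x xl [x0]; move: l20; rewrite {1}x0 xl.
Qed.

Variable n : nat.

Lemma dimY_widen N (l : seq nat) : (sumn l < N)%N ->
  dimY n l = (\prod_(1 <= j < N) 'C(dS n j, rows l j))%N.
Proof.
move=> lN; rewrite [RHS](@big_cat_nat _ _ _ (sumn l).+1) //=.
rewrite [X in (_ * X)%N]big_nat_cond [X in (_ * X)%N]big1 ?muln1 // => j.
by rewrite andbT => /andP[lj _]; rewrite rows_eq0 ?bin0.
Qed.

Lemma dimY_mapS l : 0%N \notin l -> dimY n (map S l) = dimY_shift n l.
Proof.
move=> l0; have rS j : rows (map S l) j.+1 = rows l j.
  by rewrite /rows count_map; apply: eq_count => x /=; rewrite eqSS.
rewrite (@dimY_widen (sumn l + size l).+2) ?sumn_mapS // big_ltn //.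
have -> : rows (map S l) 1 = 0%N by rewrite rS; exact/count_memPn.
rewrite bin0 mul1n big_add1 /dimY_shift (@big_cat_nat _ _ _ (sumn l).+1) //=; last first.
  by rewrite ltnS leq_addr.
rewrite [X in (_ * X)%N]big_nat_cond [X in (_ * X)%N]big1 ?muln1 => [|j].
  by apply: eq_bigr => j _; rewrite rS.
by rewrite andbT => /andP[lj _]; rewrite rS rows_eq0 ?bin0.
Qed.

(** Pascal's rule in the factor of the rows of length 1, together with
    (k + 1) 'C(n + 1, k + 1) = (n + 1) 'C(n, k). *)
Lemma dimY_rcons1 l : (dimY n (rcons l 1%N))%:R =
  (1 + n%:R : rat) / (1 + (rows l 1)%:R) * (dimY n l)%:R - (dimY n l)%:R.
Proof.
rewrite (@dimY_widen (sumn l).+2) ?sumn_rcons1 // (@dimY_widen (sumn l).+2 l) //.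
rewrite [X in X%:R = _]big_ltn // [X in (_ * X%:R - _)]big_ltn // [X in (_ - X%:R)]big_ltn //.
have -> : (\prod_(2 <= j < (sumn l).+2) 'C(dS n j, rows (rcons l 1) j))%N =
          (\prod_(2 <= j < (sumn l).+2) 'C(dS n j, rows l j))%N.
  apply: eq_big_nat => j /andP[j2 _]; rewrite /rows -cats1 count_cat /=.
  by rewrite addn0; case: eqP j2 => [<-//|_ _]; rewrite addn0.
have -> : rows (rcons l 1%N) 1 = (rows l 1).+1.
  by rewrite /rows -cats1 count_cat /= addn0 addn1.
have -> : dS n 1 = n by rewrite /dS addnK bin1.
set k := rows l 1; set Q := (\prod_(_ <= _ < _) _)%N; rewrite !natrM.
have pascal : (1 + n%:R) / (1 + k%:R) * 'C(n, k)%:R - 'C(n, k)%:R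
    = 'C(n, k.+1)%:R :> rat.
  apply/eqP; rewrite subr_eq -natrD -binS mulrAC.
  have k0 : 1 + k%:R != 0 :> rat by rewrite -mulrS pnatr_eq0.
  by rewrite -(inj_eq (mulIf k0)) divfK // -!mulrS -!natrM mul_bin_diag mulnC.
by rewrite -pascal; ring.
Qed.

(** A row of length j contributes j - 2 to the weight at h = 0, which is at
    least 1 except when j is 1 or 2. *)
Lemma sumn_lower_bound l : 0%N \notin l ->
  (3 * size l <= sumn l + 2 * rows l 1 + rows l 2)%N.
Proof.
rewrite /rows; elim: l => //= x l IH; rewrite inE negb_or => /andP[x0 /IH].
case: x x0 => [|[|[|x]]] //= _; lia.
Qed.

(** A nonzero dimension bounds the numbers of rows of length 1 and 2, and the
    weight bounds the number of the other rows; so for a given weight only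
    finitely many heights occur. *)
Lemma dimY_eq0 (h : nat) (w m : int) l : nabla (w + (2 - h%:Z) * m) m l ->
  (absz w + 2 * dS n 1 + dS n 2 < absz m)%N -> dimY n l = 0%N.
Proof.
move=> [/andP[_ l0] lm lA] hm; apply/eqP; apply: contraTT hm => dl.
have rl j : (0 < j)%N -> (rows l j <= dS n j)%N.
  move=> j0; rewrite leqNgt; apply: contraNN dl => lt.
  rewrite (@dimY_widen (maxn j (sumn l)).+1) ?ltnS ?leq_maxr //.
  rewrite (big_cat_nat _ _ (n := j)) //=; last by rewrite leqW // leq_maxl.
  by rewrite [X in (_ * X)%N]big_ltn ?ltnS ?leq_maxl // bin_small // mul0n muln0.
have := sumn_lower_bound l0; have := rl 1%N isT; have := rl 2%N isT.
move: lA; rewrite -lm; move: (rows l 1) (rows l 2) (dS n 1) (dS n 2) => a b c d.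
rewrite -leqNgt /=; nia.
Qed.

End Young.

(** * Counting the basis *)

(** A set amounts to the family of its intersections with the classes of [f]. *)
Lemma card_sets_by_class (T J : finType) (f : T -> J) (k : J -> nat) :
  #|[set A : {set T} | [forall j, #|[set a in A | f a == j]%SET| == k j]]%SET| =
  (\prod_j 'C(#|[set a | f a == j]%SET|, k j))%N.
Proof.
pose F j : {set {set T}} :=
  [set B : {set T} | B \subset [set a | f a == j]%SET & #|B| == k j]%SET.
pose g (A : {set T}) : {ffun J -> {set T}} := [ffun j => [set a in A | f a == j]%SET].
have g_inj : injective g.
  move=> A B AB; apply/setP => a; have /ffunP/(_ (f a)) := AB.
  by rewrite !ffunE => /setP/(_ a); rewrite !inE eqxx !andbT.
rewrite -(card_imset _ g_inj) (_ : imset _ _ = [set B in family F]%SET).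
  rewrite cardsE card_family foldrE big_map big_enum /=.
  by apply: eq_bigr => j _; rewrite -cards_draws; apply: eq_card => B; rewrite !inE.
apply/setP => B; rewrite inE; apply/imsetP/familyP => [[A]|BF].
  rewrite inE => /forallP hA -> j; rewrite ffunE inE hA andbT.
  by apply/fintype.subsetP => a; rewrite !inE => /andP[].
have BE j a : (a \in B j) = (a \in B (f a)) && (f a == j).
  have := BF j; rewrite inE => /andP[/fintype.subsetP BT _].
  case: eqP => [->|fj]; first by rewrite andbT.
  by rewrite andbF; apply/negP => /BT; rewrite inE => /eqP.
have gE j : [set a in [set a | a \in B (f a)] | f a == j]%SET = B j.
  by apply/setP => a; rewrite !inE [RHS]BE.
exists [set a | a \in B (f a)]%SET.
  by rewrite inE; apply/forallP => j; rewrite gE; have := BF j; rewrite inE => /andP[].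
by apply/ffunP => j; rewrite ffunE gE.
Qed.

Lemma card_monomials n D j : (0 < j)%N -> (j < D)%N ->
  #|[set a : 'X_{1..n < D} | mdeg (bmnm a) == j]%SET| = dS n j.
Proof.
move=> j0 jD; pose b := [seq s2m t | t : j.-tuple 'I_n <- enum (basis n j)].
have -> : #|[set a : 'X_{1..n < D} | mdeg (bmnm a) == j]%SET| = size b.
  rewrite cardE -(size_map (@bmnm _ _)); apply/perm_size/uniq_perm.
  - by rewrite map_inj_uniq ?enum_uniq //; exact: val_inj.
  - exact: uniq_basis.
  move=> k; rewrite -basis_cover; apply/mapP/eqP => [[a]|kj].
    by rewrite mem_enum inE => /eqP + ->.
  have kD : (mdeg k < D)%N by rewrite kj.
  by exists (BMultinom kD) => //; rewrite mem_enum inE /= kj.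
rewrite /b /dS; case: n {b} => [|n]; last by rewrite size_basis addSn subn1 addnC.
rewrite add0n bin_small ?subn1 ?prednK //; apply/eqP; rewrite size_eq0.
case: (X in X == _) (@basis_cover 0 j) => // k s /(_ k); rewrite mem_head.
by rewrite mdegE big_ord0 => /eqP j0'; rewrite -j0' in j0.
Qed.

Section Count.
Variables (n h m : nat) (w : int).
Local Notation D := (mon_bound h m w).
Local Notation T := 'X_{1..n < D}.

(** The Young diagram of a set of monomials. *)
Definition degs (A : {set T}) : seq nat := [seq mdeg k | k <- mons A].

Lemma degs_sorted A : sorted geq (degs A).
Proof.
rewrite sorted_map; apply: (@sort_sorted _ (fun a b => (mdeg b <= mdeg a)%N)).
by move=> a b; exact: leq_total.
Qed.

Lemma size_degs A : size (degs A) = #|A|.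
Proof. by rewrite size_map size_mons. Qed.

Lemma perm_degs A : perm_eq (degs A) [seq mdeg (bmnm a) | a <- enum A].
Proof. by rewrite [X in perm_eq _ X]map_comp perm_map // perm_sort. Qed.

Lemma rows_degs A j : rows (degs A) j = #|[set a in A | mdeg (bmnm a) == j]%SET|.
Proof.
rewrite /rows (seq.permP (perm_degs A)) count_map -size_filter cardE.
apply/perm_size/uniq_perm => [||a]; last 1 first.
- by rewrite mem_filter !mem_enum [RHS]inE /= andbC.
- exact/filter_uniq/enum_uniq.
- exact: enum_uniq.
Qed.

Lemma sumn_degs A : sumn (degs A) = (\sum_(a in A) mdeg (bmnm a))%N.
Proof. by rewrite (perm_sumn (perm_degs A)) sumnE big_map big_enum. Qed.

Lemma mon_setsE A : (A \in mon_index n h m w) = young (degs A) && (size (degs A) == m)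
   && ((sumn (degs A))%:Z == w + (2 - h%:Z) * m%:Z).
Proof.
have E0 : [forall a in A, (0 < mdeg (bmnm a))%N] = (0%N \notin degs A).
  apply/forall_inP/idP => [H|H a aA].
    apply/negP; rewrite (perm_mem (perm_degs A)) => /mapP[a]; rewrite mem_enum => /H.
    by move=> + E; rewrite -E.
  rewrite lt0n; apply: contraNneq H => <-; rewrite (perm_mem (perm_degs A)).
  by apply/mapP; exists a; rewrite ?mem_enum.
have Ew : \sum_(a in A) ((mdeg (bmnm a))%:Z - 2 + h%:Z) =
   (\sum_(a in A) mdeg (bmnm a))%N%:Z - (2 - h%:Z) * #|A|%:Z.
  transitivity (\sum_(a in A) ((mdeg (bmnm a))%:Z - (2 - h%:Z))).
    by apply: eq_bigr => a _; rewrite opprB -addrA [- 2 + _]addrC.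
  by rewrite sumrB sumr_const -[_ *+ _]mulr_natr natz (raddf_sum Posz).
rewrite inE size_degs sumn_degs /young degs_sorted E0 Ew /= [RHS]andbAC.
rewrite [RHS]andbC [RHS]andbCA andbA andbAC; case: eqVneq => [->|] /=.
  by rewrite subr_eq andbC.
by rewrite !andbF.
Qed.

(** The basis is classified by the diagrams of its index sets. Since the bound D
    exceeds the area by exactly one, the degrees below D are those that occur in
    [dimY], and degree 0, whose factor is 1. *)
Lemma dimC_nabla : (dimC n h m w)%:R =
  \sum_(l \in nabla (w + (2 - h%:Z) * m%:Z) m%:Z) ((dimY n l)%:R : rat).
Proof.
rewrite fsbig_finite /=; last exact: finite_nabla.
set r := enum_fset _.
have inr l : (l \in r) = `[< nabla (w + (2 - h%:Z) * m%:Z) m%:Z l >].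
  rewrite -[r]/(enum_fset (fset_set _)) in_fset_set ?inE //.
  exact: finite_nabla.
have -> : dimC n h m w = (\sum_(l <- r) #|[set A in mon_index n h m w | degs A == l]%SET|)%N.
  rewrite -[LHS]sum1_card.
  transitivity (\sum_(A in mon_index n h m w) \sum_(l <- r) (degs A == l))%N.
    apply: eq_bigr => A AI; rewrite (bigD1_seq (degs A)) ?fset_uniq //=; last first.
      rewrite inr; apply/asboolP; move: AI; rewrite mon_setsE.
      by move=> /andP[/andP[yA /eqP sA] /eqP wA]; split; rewrite ?sA.
    by rewrite eqxx big1 // => l /negbTE; rewrite eq_sym => ->.
  rewrite exchange_big /=; apply: eq_bigr => l _.
  rewrite -sum1_card big_mkcond [in RHS]big_mkcond /=; apply: eq_bigr => A _.
  by rewrite [X in _ = if X then _ else _]inE; case: (A \in _); case: eqP.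
rewrite natr_sum !big_seq; apply: eq_bigr => l; rewrite inr => /asboolP[yl lm lA].
congr (_%:R).
have DE : D = (sumn l).+1 by rewrite /mon_bound -lA.
transitivity (#|[set A : {set T} | [forall j : 'I_D,
    #|[set a in A | Ordinal (bmdeg a) == j]%SET| == rows l j]]%SET|).
  apply: eq_card => A; rewrite [LHS]inE [RHS]inE mon_setsE.
  have rA (j : 'I_D) : #|[set a in A | Ordinal (bmdeg a) == j]%SET| = rows (degs A) j.
    by rewrite rows_degs; apply: eq_card => a; rewrite !inE.
  apply/andP/forallP => [[_ /eqP <- j]|H]; first by rewrite rA.
  suff E : degs A = l by split; [rewrite E yl lA eqxx andbT; apply/eqP; case: lm | apply/eqP].
  apply: (@sorted_eq _ geq).
  - by move=> x y z; rewrite /geq /= => h1 h2; exact: leq_trans h2 h1.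
  - by move=> x y; rewrite /geq /= andbC -eqn_leq => /eqP.
  - exact: degs_sorted.
  - by case/andP: yl.
  apply/allP => j _; apply/eqP; rewrite -/(rows _ j) -/(rows l j).
  have [jD|jD] := ltnP j D.
    by have := H (Ordinal jD); rewrite rA => /eqP.
  rewrite [RHS]rows_eq0 -?DE // rows_degs; apply: eq_card0 => a; rewrite inE.
  by rewrite (ltn_eqF (leq_trans (bmdeg a) jD)) andbF.
rewrite card_sets_by_class /dimY -DE.
rewrite (eq_bigr (fun j : 'I_D =>
   'C(#|[set a : T | mdeg (bmnm a) == j]%SET|, rows l j))); last first.
  by move=> j _; congr ('C(_, _)); apply: eq_card => a; rewrite !inE.
rewrite -(big_mkord xpredT (fun j => 'C(#|[set a : T | mdeg (bmnm a) == j]%SET|, rows l j))).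
rewrite big_ltn //.
have -> : rows l 0 = 0%N by apply/count_memPn; case/andP: yl.
rewrite bin0 mul1n; apply: eq_big_nat => j /andP[j0 jD].
by rewrite card_monomials.
Qed.

End Count.

(** * The recursion *)

Lemma fsbig_nat_trunc (V : nmodType) (F : nat -> V) M :
  (forall m, (M <= m)%N -> F m = 0) ->
  \sum_(m \in [set: nat]) F m = \sum_(m < M) F m.
Proof.
move=> FM; rewrite fsbig_ord; symmetry; apply: fsbig_widen => //.
by move=> m [_ /= /negP]; rewrite -leqNgt => /FM.
Qed.

Section Euler.
Variables (R : realType) (n h : nat) (p : 'M[{mpoly R[n]}]_n).
Hypothesis hp : homogeneous_poisson h p.

Definition weight_bound (w : int) : nat := (absz w + 2 * dS n 1 + dS n 2).+1.

Lemma dimC_eq0 w m : (weight_bound w <= m)%N -> dimC n h m w = 0%N.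
Proof.
move=> hm; apply/eqP; rewrite -(pnatr_eq0 rat) dimC_nabla fsbig1 // => l ml.
by rewrite (dimY_eq0 ml).
Qed.

Lemma euler_char_dimC w M : (weight_bound w <= M)%N ->
  euler_char h p w = \sum_(m < M) (-1) ^+ m * (dimC n h m w)%:Z.
Proof.
move=> hM.
have dimM m : (M <= m)%N -> dimC n h m w = 0%N.
  by move=> Mm; apply: dimC_eq0; exact: leq_trans Mm.
have C_sum m (u : 'rV[R]_(dimC n h m w)) :
    cochains h m w (\sum_i u 0 i *: @mon_basis R n h m w i).
  apply/cochainsE/wform_sum => i; apply/cochainsE.
  by case: (cochains_basis R n h m w).
have dC m (s : ('I_m -> {mpoly R[n]}) -> R^o) :
    cochains h m w s -> cochains h m.+1 w (coboundary p s).
  by move=> /cochainsE ws; apply/cochainsE/wform_coboundary.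
have ddC m (s : ('I_m -> {mpoly R[n]}) -> R^o) :
    cochains h m w s -> coboundary p (coboundary p s) = 0.
  by move=> /cochainsE; exact: coboundaryK.
have [EP dimH0] := @euler_poincare R (fun m => ('I_m -> {mpoly R[n]}) -> R^o)
  (fun m => cochains h m w) (@coboundary R n p)
  (fun m => dimC n h m w) (fun m => @mon_basis R n h m w)
  (@coboundary_lin R n p) (fun m => cochains_basis R n h m w) C_sum dC ddC M dimM.
rewrite -EP /euler_char; apply: fsbig_nat_trunc => m /dimH0.
rewrite -[complex_dimH _ _ _]/(dimH h p m w) => ->.
by rewrite mulr0.
Qed.

End Euler.

(** The two parts of [nabla_split], with the dimensions computed by [dimY_rcons1]
    and [dimY_mapS]. *)
Lemma sum_nabla_recursion n (A : int) (m : nat) :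
  \sum_(l \in nabla A m%:Z) ((dimY n l)%:R : rat) =
    \sum_(l \in nabla (A - 1) (m%:Z - 1))
       ((1 + n%:R : rat) / (1 + (rows l 1)%:R) * (dimY n l)%:R)
    - \sum_(l \in nabla (A - 1) (m%:Z - 1)) ((dimY n l)%:R : rat)
    + \sum_(l \in nabla (A - m%:Z) m%:Z) ((dimY_shift n l)%:R : rat).
Proof.
rewrite nabla_split fsbigU; last first.
- have := nabla_split_disjoint (A - 1) (A - m%:Z) (m%:Z - 1).
  by rewrite subrK => ->; exact: sub0set.
- exact/finite_image/finite_nabla.
- exact/finite_image/finite_nabla.
congr (_ + _).
  rewrite fsbig_image; last by move=> x y _ _ /rcons_inj[].
  rewrite (eq_fsbigr (fun l => (1 + n%:R : rat) / (1 + (rows l 1)%:R) * (dimY n l)%:R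
     + - (dimY n l)%:R)); last by move=> l _; exact: dimY_rcons1.
  rewrite (fsbig_split _ _ _ (finite_nabla _ _)) /=; congr (_ + _).
  by rewrite !fsbig_finite ?sumrN //; exact: finite_nabla.
rewrite fsbig_image; last by move=> x y _ _ /inj_map; apply; exact: succn_inj.
by apply: eq_fsbigr => l /set_mem[/andP[_ l0] _ _]; rewrite dimY_mapS.
Qed.

Theorem lemma8p1 (R : realType) (n h : nat) (p : 'M[{mpoly R[n]}]_n)
    (hp : homogeneous_poisson h p) (w : int) :
  (euler_char h p w)%:~R =
    (euler_char h p (w + 1 - h%:Z))%:~R
    + \sum_(m \in [set: nat]) (-1) ^+ m *
        (\sum_(l \in nabla (w + 1 - h%:Z + (2 - h%:Z) * (m%:Z - 1)) (m%:Z - 1))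
           (1 + n%:R : rat) / (1 + (rows l 1)%:R) * (dimY n l)%:R)
    + \sum_(m \in [set: nat]) (-1) ^+ m *
        (\sum_(l \in nabla (w + (1 - h%:Z) * m%:Z) m%:Z)
           ((dimY_shift n l)%:R : rat))
  :> rat.
Proof.
set w' := w + 1 - h%:Z.
pose M := maxn (weight_bound n w) (weight_bound n w').
have wM : (weight_bound n w <= M)%N by rewrite leq_maxl.
have wM' : (weight_bound n w' <= M)%N by rewrite leq_maxr.
have intE w0 M0 : ((\sum_(m < M0) (-1) ^+ m * (dimC n h m w0)%:Z)%:~R : rat) =
   \sum_(m < M0) (-1) ^+ m * (dimC n h m w0)%:R.
  by rewrite rmorph_sum; apply: eq_bigr => m _; rewrite rmorphM rmorphXn /= rmorphN1.
rewrite (euler_char_dimC hp (leqW wM)) (euler_char_dimC hp wM') !intE.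
rewrite (@fsbig_nat_trunc _ _ M.+1) => [|m mM]; last first.
  rewrite fsbig1 ?mulr0 // => l ml; rewrite (dimY_eq0 ml) ?mulr0 //.
  case: m mM {ml} => // m mM; have -> : m.+1%:Z - 1 = m%:Z by lia.
  exact: leq_trans wM' _.
rewrite (@fsbig_nat_trunc _ _ M.+1) => [|m mM]; last first.
  rewrite fsbig1 ?mulr0 // => l [/andP[sl l0] lm lA]; rewrite -dimY_mapS //.
  rewrite (@dimY_eq0 n h w m%:Z) //; last exact: leq_trans wM (ltnW mM).
  by split; rewrite ?young_mapS ?size_map // sumn_mapS PoszD lm lA; ring.
(* The terms of degree m - 1 and weight w', moved to degree m; for m = 0 there
   are none, as no diagram has height -1. *)
have shift : \sum_(m < M) (-1) ^+ m * (dimC n h m w')%:R =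
  - \sum_(m < M.+1) (-1) ^+ m *
     \sum_(l \in nabla (w' + (2 - h%:Z) * (m%:Z - 1)) (m%:Z - 1)) ((dimY n l)%:R : rat).
  rewrite big_ord_recl /= [X in _ * X]fsbig1 => [|l [_ //]].
  rewrite mulr0 add0r -sumrN; apply: eq_bigr => m _.
  rewrite /bump /= add1n; have -> : m.+1%:Z - 1 = m%:Z by lia.
  by rewrite dimC_nabla exprS mulN1r mulNr opprK.
rewrite shift -sumrN -!big_split /=; apply: eq_bigr => m _.
rewrite dimC_nabla sum_nabla_recursion.
have -> : w + (2 - h%:Z) * m%:Z - 1 = w' + (2 - h%:Z) * (m%:Z - 1) by rewrite /w'; ring.
have -> : w + (2 - h%:Z) * m%:Z - m%:Z = w + (1 - h%:Z) * m%:Z by ring.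
ring.
Qed.
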